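(* Let $n\ge1$, $Q=2n+2$, $m\in\mathbb{N}$ ($m\ge1$), $1<q<\infty$, $1<q_j<\infty$ and $\alpha_j\in\mathbb{R}$ for $j=1,\dots,m$, with $\frac1q=\frac1{q_1}+\cdots+\frac1{q_m}$ and $\alpha=\alpha_1+\cdots+\alpha_m$. Let $K:(\mathbb{H}^n)^m\to(0,\infty)$ be a measurable radial kernel, i.e. $K(y_1,\dots,y_m)$ depends only on $(|y_1|_h,\dots,|y_m|_h)$, such that $$C^h:=\int_{\mathbb{H}^n}\cdots\int_{\mathbb{H}^n}K(y_1,\dots,y_m)\prod_{j=1}^m|y_j|_h^{-\frac{\alpha_j}{q}-\frac{Q}{q_j}}\,dy_1\cdots dy_m<\infty.$$ For measurable radial functions $f_1,\dots,f_m$ on $\mathbb{H}^n$ define $$\mathcal{H}^h(f_1,\dots,f_m)(x)=\int_{\mathbb{H}^n}\cdots\int_{\mathbb{H}^n}K(y_1,\dots,y_m)\,f_1(\delta_{|x|_h}y_1)\cdots f_m(\delta_{|x|_h}y_m)\,dy_1\cdots dy_m,\qquad x\in\mathbb{H}^n\setminus\{0\}.$$ Then, as an $m$-linear operator acting on radial functions $f_j\in L^{q_j}(\mathbb{H}^n,|x|_h^{q_j\alpha_j/q})$, $$\left\|\mathcal{H}^h\right\|_{L^{q_1}(\mathbb{H}^n,|x|_h^{q_1\alpha_1/q})\times\cdots\times L^{q_m}(\mathbb{H}^n,|x|_h^{q_m\alpha_m/q})\to L^q(\mathbb{H}^n,|x|_h^{\alpha})}=C^h.$$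
   Context: The Heisenberg group $\mathbb{H}^n$ is, as a manifold, $\mathbb{R}^{2n+1}$; its Haar measure is Lebesgue measure $dx$ on $\mathbb{R}^{2n+1}$, its dilations are $\delta_r(x_1,\dots,x_{2n},x_{2n+1})=(rx_1,\dots,rx_{2n},r^2x_{2n+1})$ for $r>0$, and its homogeneous dimension is $Q=2n+2$. The homogeneous norm is $|x|_h=\big[\big(\sum_{i=1}^{2n}x_i^2\big)^2+x_{2n+1}^2\big]^{1/4}$. A function $f$ on $\mathbb{H}^n$ is radial if $f(x)$ depends only on $|x|_h$. For a positive measurable weight $w$ (defined almost everywhere), $\|f\|_{L^p(\mathbb{H}^n,w)}=\big(\int_{\mathbb{H}^n}|f(x)|^pw(x)\,dx\big)^{1/p}$. The operator norm of the $m$-linear operator is the supremum of $$\frac{\|\mathcal{H}^h(f_1,\dots,f_m)\|_{L^q(\mathbb{H}^n,|x|_h^{\alpha})}}{\prod_{j=1}^m\|f_j\|_{L^{q_j}(\mathbb{H}^n,|x|_h^{q_j\alpha_j/q})}}$$ over all radial $f_j$ with $0<\|f_j\|_{L^{q_j}(\mathbb{H}^n,|x|_h^{q_j\alpha_j/q})}<\infty$, $j=1,\dots,m$. *)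

(* Defs.v *)
From HB Require Import structures.
From mathcomp Require Import all_boot all_order all_algebra.
From mathcomp Require Import all_classical all_reals all_analysis.
From mathcomp Require Import measurable_realfun.

Set Implicit Arguments.
Unset Strict Implicit.
Unset Printing Implicit Defensive.

Import Order.TTheory GRing.Theory Num.Theory.
Import numFieldNormedType.Exports.

Local Open Scope classical_set_scope.
Local Open Scope ring_scope.
Local Open Scope ereal_scope.

Definition tcons (T : Type) n (p : T * n.-tuple T) : n.+1.-tuple T :=
  [tuple of p.1 :: p.2].

Lemma tcons_behead (T : Type) n (x : T) (t : n.-tuple T) :
  behead_tuple (tcons (x, t)) = t.
Proof. exact: val_inj. Qed.

Section tuple_measure.
Context d (T : measurableType d) (R : realType).
Variable mu : {sigma_finite_measure set T -> \bar R}.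

Lemma measurable_tcons n :
  measurable_fun [set: T * n.-tuple T] (@tcons T n).
Proof. by apply: measurable_cons; [exact: measurable_fst|exact: measurable_snd]. Qed.

Section cons_measure.
Variables (n : nat) (nu : {sigma_finite_measure set (n.-tuple T) -> \bar R}).

Definition cons_measure : set (n.+1.-tuple T) -> \bar R :=
  pushforward (mu \x nu) (@tcons T n).

Let cons_measure0 : cons_measure set0 = 0.
Proof. by rewrite /cons_measure /pushforward preimage_set0 measure0. Qed.

Let cons_measure_ge0 A : 0 <= cons_measure A.
Proof. by rewrite /cons_measure /pushforward measure_ge0. Qed.

Let cons_measure_sigma_additive : semi_sigma_additive cons_measure.
Proof.
move=> F mF tF mUF; rewrite /cons_measure /pushforward preimage_bigcup.
apply: measure_semi_sigma_additive.
- by move=> k; rewrite -[X in measurable X]setTI; exact: measurable_tcons.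
- apply/trivIsetP => /= i j _ _ ij; rewrite -preimage_setI.
  by move/trivIsetP : tF => /(_ _ _ _ _ ij) ->//; rewrite preimage_set0.
- by rewrite -preimage_bigcup -[X in measurable X]setTI; exact: measurable_tcons.
Qed.

HB.instance Definition _ := isMeasure.Build _ _ _ cons_measure
  cons_measure0 cons_measure_ge0 cons_measure_sigma_additive.

Let cons_measure_sigma_finite : sigma_finite setT cons_measure.
Proof.
have /sigma_finiteP[F [TF ndF Foo]] := sigma_finiteT mu.
have /sigma_finiteP[G [TG ndG Goo]] := sigma_finiteT nu.
exists (fun k => [set t | F k (thead t) /\ G k (behead_tuple t)]).
  apply/esym; rewrite -subTset => t _.
  have : [set: T] (thead t) by []. rewrite TF => -[i _ Fi].
  have : [set: n.-tuple T] (behead_tuple t) by []. rewrite TG => -[j _ Gj].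
  exists (maxn i j) => //; split.
    by move: (thead t) Fi; exact/subsetPset/ndF/leq_maxl.
  by move: (behead_tuple t) Gj; exact/subsetPset/ndG/leq_maxr.
move=> k; have [mFk Fk] := Foo k; have [mGk Gk] := Goo k; split.
  apply: measurableI; rewrite -[X in measurable X]setTI.
    exact: (measurable_tnth ord0).
  exact: measurable_behead.
rewrite /cons_measure /pushforward (_ : _ @^-1` _ = F k `*` G k).
  by rewrite product_measure1E// lte_mul_pinfty// ge0_fin_numE.
rewrite eqEsubset; split => -[x t] [Fx Gt]; split => //.
  by move: Gt; rewrite tcons_behead.
by rewrite tcons_behead.
Qed.

HB.instance Definition _ := Measure_isSigmaFinite.Build _ _ _ cons_measure
  cons_measure_sigma_finite.

End cons_measure.

Lemma dirac_nil_sigma_finite :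
  sigma_finite [set: 0.-tuple T] (@dirac _ _ ([tuple] : 0.-tuple T) R).
Proof.
exists (fun=> setT); first by rewrite bigcup_const.
by move=> _; split => //; rewrite diracT ltry.
Qed.

Definition nil_measure : set (0.-tuple T) -> \bar R :=
  dirac ([tuple] : 0.-tuple T).
HB.instance Definition _ := Measure.on nil_measure.
HB.instance Definition _ := Measure_isSigmaFinite.Build _ _ _ nil_measure
  dirac_nil_sigma_finite.

(* The n-fold product measure mu \x ... \x mu; see tuple_measureE. *)
Fixpoint tuple_measure n : {sigma_finite_measure set (n.-tuple T) -> \bar R} :=
  match n with
  | 0 => nil_measure
  | k.+1 => cons_measure (tuple_measure k)
  end.

Lemma tuple_measureE n (A : 'I_n -> set T) :
  (forall i, measurable (A i)) ->
  tuple_measure n [set x | forall i, A i (tnth x i)] = \prod_(i < n) mu (A i).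
Proof.
elim: n A => [|n IHn] A mA /=.
  rewrite big_ord0 /nil_measure diracE mem_set//= => -[]//.
rewrite big_ord_recl -IHn// -product_measure1E//; last first.
  rewrite (_ : [set x | _] = \bigcap_(i : 'I_n) ((@tnth n T ^~ i) @^-1` A (lift ord0 i))).
    apply: fin_bigcap_measurable => //= i _.
    by rewrite -[X in measurable X]setTI; exact: measurable_tnth.
  by apply/seteqP; split => x /= h i; [move=> _|]; exact: h.
rewrite /cons_measure /pushforward; congr (_ _).
apply/seteqP; split => -[x t] /=.
  move=> h; split => /=; first exact: (h ord0).
  by move=> i; have := h (lift ord0 i); rewrite tnthS.
move=> [Ax At] i; case: (unliftP ord0 i) => [j|] -> //.
by rewrite tnthS.
Qed.

End tuple_measure.

(* Measurability with respect to the completion of mu. The library integral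
   (of the positive part: supremum over the measurable simple functions below
   it) computes, for such functions, the integral for the completed measure. *)
Definition completed_measurable_fun d (T : measurableType d) (R : realType)
    (mu : set T -> \bar R) (f : T -> R) : Prop :=
  forall B : set R, measurable B -> completed_algebra_gen mu (f @^-1` B).

Notation heis R n := ((2 * n)%N.+1.-tuple (measurableTypeR R)).

Section heisenberg.
Context (R : realType) (n : nat).
Local Notation heis := (heis R n).

Definition heis_measure : {sigma_finite_measure set heis -> \bar R} :=
  tuple_measure (@lebesgue_measure R) (2 * n).+1.

Definition heis_dim : nat := 2 * n + 2.

Implicit Types x y : heis.

Definition hnorm x : R :=
  (((\sum_(i < 2 * n) tnth x (widen_ord (leqnSn (2 * n)) i) ^+ 2) ^+ 2
    + tnth x ord_max ^+ 2) `^ 4^-1)%R.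

Definition hdilation (r : R) x : heis :=
  [tuple (if i == ord_max then r ^+ 2 * tnth x i else r * tnth x i)%R
     | i < (2 * n).+1].

Definition radial (f : heis -> R) : Prop :=
  forall x y, hnorm x = hnorm y -> f x = f y.

Definition radial_kernel m (K : m.-tuple heis -> R) : Prop :=
  forall y z : m.-tuple heis,
    (forall j, hnorm (tnth y j) = hnorm (tnth z j)) -> K y = K z.

(* The norm of L^p(H^n, |x|_h^a); all weights here are of this form. *)
Definition hLnorm (p a : R) (f : heis -> \bar R) : \bar R :=
  (\int[heis_measure]_x (`|f x| `^ p * (hnorm x `^ a)%:E)) `^ p^-1.

(* At a point where the integral does not converge absolutely the value is
   +oo or -oo; so a finite hLnorm of hausdorff K f entails absolute
   convergence almost everywhere. *)
Definition hausdorff m (K : m.-tuple heis -> R) (f : 'I_m -> heis -> R) x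
    : \bar R :=
  \int[tuple_measure heis_measure m]_y
    (K y * \prod_(j < m) f j (hdilation (hnorm x) (tnth y j)))%:E.

Definition hausdorff_const m (K : m.-tuple heis -> R) (q : R)
    (qs alphas : 'I_m -> R) : \bar R :=
  \int[tuple_measure heis_measure m]_y
    (K y * \prod_(j < m)
       hnorm (tnth y j) `^ (- (alphas j / q) - heis_dim%:R / qs j))%:E.

Definition hausdorff_opnorm m (K : m.-tuple heis -> R) (q : R)
    (qs alphas : 'I_m -> R) (alpha : R) : \bar R :=
  ereal_sup [set r | exists f : 'I_m -> heis -> R,
    (forall j, [/\ completed_measurable_fun heis_measure (f j), radial (f j),
       0 < hLnorm (qs j) (qs j * alphas j / q) (EFin \o f j) &
       hLnorm (qs j) (qs j * alphas j / q) (EFin \o f j) < +oo]) /\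
    r = hLnorm q alpha (hausdorff K f) /
        \prod_(j < m) hLnorm (qs j) (qs j * alphas j / q) (EFin \o f j)].

End heisenberg.

(* Main.v *)
Require Import Defs.
From mathcomp Require Import all_boot all_order all_algebra.
From mathcomp Require Import all_classical all_reals all_analysis.
From HB Require Import structures.
From mathcomp Require Import measurable_realfun ring lra.
Set Implicit Arguments.
Unset Strict Implicit.
Unset Printing Implicit Defensive.
Import Order.TTheory GRing.Theory Num.Theory.
Local Open Scope ring_scope.

(* Upper bound: write H^h(f)(x) as the integral of w P(x, .), where
   w = K(y) prod_j |y_j|_h^(-alpha_j/q - Q/q_j) has integral C^h. Jensen gives
   |H^h(f)(x)|^q <= (C^h)^(q-1) int w P(x, .)^q. Since f_j is radial,
   f_j(delta_|x| y_j) = f_j(delta_|y_j| x), so after the weighted AM-GM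
   inequality with weights q/q_j and Tonelli, the scaling of Haar measure under
   delta_|y_j| computes the x-integral. Measurability for the completed measure
   is reduced to Borel measurability by radial_version.
   Lower bound: for f_j = |x|_h^(-alpha_j/q - Q/q_j) on the union of the shells
   r^i <= |x|_h < r^(i+1), i < k + 2, each shell contributes equally to the norm
   of f_j, and on the k middle shells H^h(f)(x) is at least |x|_h^(-(alpha+Q)/q)
   times the part of C^h over 1/r <= |y_j|_h < r. So the quotient of norms is at
   least that part times (k/(k+2))^(1/q); let k and then r tend to infinity. *)

Lemma preimage_measurable d1 d2 (T1 : measurableType d1) (T2 : measurableType d2)
    (f : T1 -> T2) (A : set T2) :
  measurable_fun setT f -> measurable A -> measurable (f @^-1` A)%classic.
Proof. by move=> mf mA; rewrite -[X in measurable X]setTI; exact: mf. Qed.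

(** * Null sets, integrals, and Borel versions of completed-measurable functions *)

Section null_modification.
Local Open Scope classical_set_scope.
Local Open Scope ereal_scope.
Context d (T : measurableType d) (R : realType) (mu : {measure set T -> \bar R}).
Implicit Types (f g : T -> \bar R) (M : set T).

Import HBNNSimple.

(* No measurability of f and g is needed: a simple function below f is not
   changed in measure when it is set to 0 on M, and is then below g. *)
Lemma le_integral_off_null M f g : measurable M -> mu M = 0 ->
  (forall x, 0 <= f x) -> (forall x, 0 <= g x) ->
  (forall x, ~ M x -> f x <= g x) ->
  \int[mu]_x f x <= \int[mu]_x g x.
Proof.
move=> mM M0 f0 g0 fg; rewrite !ge0_integralTE//.
apply: ge_ereal_sup => _ [h /= hf <-].
have mCM : measurable (~` M) by exact: measurableC.
apply: ereal_sup_ubound; exists (proj_nnsfun h mCM).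
  move=> x /=; rewrite /proj_nnsfun/= mindicE; case: (boolP (x \in ~` M)) => [|_].
    rewrite inE => xM; rewrite mulr1; exact: (le_trans (hf x) (fg _ xM)).
  by rewrite mulr0.
rewrite -!integralT_nnsfun; apply: ae_eq_integral => //.
- exact/measurable_EFinP.
- exact/measurable_EFinP.
- exists M; split => //= x /= hx; apply: contrapT => Mx; apply: hx => _.
  by rewrite mindicE mem_set// mulr1.
Qed.

(** The preceding comparison is applied in both directions to the positive and to the negative
    parts. *)
Lemma eq_integral_off_null M f g : measurable M -> mu M = 0 ->
  (forall x, ~ M x -> f x = g x) ->
  \int[mu]_x f x = \int[mu]_x g x.
Proof.
move=> mM M0 fg; rewrite (integralE _ _ f) (integralE _ _ g).
have le f' g' : (forall x, ~ M x -> f' x = g' x) ->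
    \int[mu]_x f'^\+ x <= \int[mu]_x g'^\+ x /\
    \int[mu]_x f'^\- x <= \int[mu]_x g'^\- x.
  move=> fg'; split; (apply: (le_integral_off_null mM M0) => [x|x|x Mx];
    [exact: funepos_ge0 || exact: funeneg_ge0..|]).
    by rewrite !funeposE fg'.
  by rewrite !funenegE fg'.
have [lep len] := le f g fg.
have [gep gen] := le g f (fun x Mx => esym (fg x Mx)).
by congr (_ - _); apply/eqP; rewrite eq_le ?lep ?gep ?len ?gen.
Qed.

(** Each superlevel set of f at a rational height is Borel up to a null set. Countably many
    exceptional sets are collected into one null set M, on which f is replaced by 0. *)
Lemma completed_version (f : T -> R) : completed_measurable_fun mu f ->
  exists M, [/\ measurable M, mu M = 0 &
    measurable_fun setT (fun x => if x \in M then 0%R else f x)].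
Proof.
move=> mf.
have mq (r : rat) : exists AN : set T * set T, [/\ measurable AN.1,
    measurable AN.2, mu AN.2 = 0 &
    forall x, ~ AN.2 x -> (AN.1 x <-> (ratr r < f x)%R)].
  have [A mA [N [N' [mN' N'0 NN']] AN]] := mf `]ratr r, +oo[ (measurable_itv _).
  exists (A, N'); split => //= x N'x.
  have -> : (ratr r < f x)%R = (f @^-1` `]ratr r, +oo[) x :> Prop.
    by rewrite /preimage/= in_itv/= andbT.
  by rewrite -AN; split => [|[//|/NN']]; [left|].
have [F HF] := choice mq.
(* The rationals are enumerated by [unpickle], which makes this a union over the naturals. *)
pose M := \bigcup_(k in [set: nat]) (if unpickle k is Some r then (F r).2 else set0).
have mM : measurable M.
  apply: bigcup_measurable => k _; case: (unpickle k) => [r|//].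
  by have [] := HF r.
exists M; split => //.
  apply/negligibleP => //; apply: negligible_bigcup => k.
  case: (unpickle k) => [r|]; last exact: negligible_set0.
  by have [_ mN N0 _] := HF r; exact/negligibleP.
have MF x r : ~ M x -> ~ (F r).2 x.
  by move=> Mx Fx; apply: Mx; exists (pickle r); [exact: I|rewrite pickleK].
apply: (measurability _ (RGenOInfty.measurableE R)).
move=> _ [_ [a ->] <-]; rewrite setTI.
pose B := \bigcup_(k in [set: nat]) (if unpickle k is Some r then
   if (a < ratr r)%R then (F r).1 else set0 else set0).
have mB : measurable B.
  apply: bigcup_measurable => k _; case: (unpickle k) => [r|//].
  by case: ifP => // _; have [] := HF r.
(* Off M, f x exceeds a exactly when it exceeds some rational above a. On M the modified function is
   0, so M lies in the preimage exactly when a < 0. *)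
rewrite (_ : _ @^-1` _ = (B `\` M) `|` (if (a < 0)%R then M else set0)).
  apply: measurableU; first exact: measurableD.
  by case: ifP.
apply/seteqP; split => x /=; rewrite in_itv/= andbT.
  case: ifPn => [|/negP xM afx].
    by rewrite inE => Mx a0; right; rewrite a0.
  have {}xM : ~ M x by move=> Mx; apply: xM; rewrite inE.
  left; split => //.
  have [r] := rat_in_itvoo afx; rewrite in_itv/= => /andP[ar rf].
  exists (pickle r); first exact: I.
  rewrite pickleK ar; have [_ _ _ /(_ x (MF x r xM)) e] := HF r.
  exact/e.
move=> [[[k _]]|].
  case: (unpickle k) => [r|//]; case: ifP => // ar Fx xM.
  rewrite memNset//; apply: (lt_trans ar).
  have [_ _ _ /(_ x (MF x r xM)) e] := HF r.
  exact/e.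
by case: ifP => // a0 Mx; rewrite mem_set.
Qed.

Lemma completed_measurable_funW (f : T -> R) :
  measurable_fun setT f -> completed_measurable_fun mu f.
Proof.
move=> mf B mB; exists (f @^-1` B).
  exact: preimage_measurable.
by exists set0; [exact: negligible_set0|rewrite setU0].
Qed.

End null_modification.

(** * Tonelli and null sets for the product measure on tuples *)

Section tuple_measure_integral.
Local Open Scope classical_set_scope.
Local Open Scope ereal_scope.

(** The measure on tuples is the image of a binary product under [tcons], so Tonelli splits off the
    first coordinate. *)
Lemma integral_tuple_measureS d (T : measurableType d) (R : realType)
    (mu : {sigma_finite_measure set T -> \bar R}) n
    (f : n.+1.-tuple T -> \bar R) :
  measurable_fun setT f -> (forall t, 0 <= f t) ->
  \int[tuple_measure mu n.+1]_t f t =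
  \int[mu]_x \int[tuple_measure mu n]_t f (tcons (x, t)).
Proof.
move=> mf f0.
rewrite -[LHS]/(\int[pushforward (mu \x tuple_measure mu n) (@tcons T n)]_t f t).
rewrite (ge0_integral_pushforward (@measurable_tcons _ _ n))//.
rewrite preimage_setT fubini_tonelli1//=.
by apply: measurableT_comp => //; exact: measurable_tcons.
Qed.

Lemma integral_tuple_measure0 d (T : measurableType d) (R : realType)
    (mu : {sigma_finite_measure set T -> \bar R}) (f : 0.-tuple T -> \bar R) :
  measurable_fun setT f ->
  \int[tuple_measure mu 0]_t f t = f [tuple].
Proof.
move=> mf.
rewrite -[LHS]/(\int[@dirac _ _ ([tuple] : 0.-tuple T) R]_t f t).
by rewrite integral_dirac// diracT mul1e.
Qed.

Lemma tuple_measure_null_coordinate d (T : measurableType d) (R : realType)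
    (mu : {sigma_finite_measure set T -> \bar R}) n (j : 'I_n) (M : set T) :
  measurable M -> mu M = 0 ->
  tuple_measure mu n [set t | M (tnth t j)] = 0.
Proof.
move=> mM M0.
rewrite (_ : [set t | _] =
  [set t | forall i, (if i == j then M else setT) (tnth t i)]).
  rewrite (@tuple_measureE _ _ _ _ _ (fun i => if i == j then M else setT));
    last by move=> i; case: ifP.
  (* The null side makes the whole product 0 even if other sides have infinite measure, since 0
     times +oo is 0. *)
  by rewrite (bigD1 j)//= eqxx M0 mul0e.
apply/seteqP; split => t /=.
  by move=> Mt i; case: ifP => // /eqP ->.
by move=> /(_ j); rewrite eqxx.
Qed.

Lemma tuple_measure_null_coordinates d (T : measurableType d) (R : realType)
    (mu : {sigma_finite_measure set T -> \bar R}) n (Z : 'I_n -> set T) :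
  (forall j, measurable (Z j)) -> (forall j, mu (Z j) = 0) ->
  measurable [set t | exists j, Z j (tnth t j)] /\
  tuple_measure mu n [set t | exists j, Z j (tnth t j)] = 0.
Proof.
move=> mZ Z0.
(* The finite family is extended by empty sets to a sequence, so that countable unions apply. *)
pose W (k : nat) : set (n.-tuple T) :=
  if insub k is Some j then [set t | Z j (tnth t j)] else set0.
have WE : [set t | exists j, Z j (tnth t j)] = \bigcup_k W k.
  apply/seteqP; split => [t [j tj]|t [k _]].
    by exists (val j) => //; rewrite /W valK.
  by rewrite /W; case: insub => // j tj; exists j.
have mW k : measurable (W k).
  rewrite /W; case: insub => [j|//].
  exact: (preimage_measurable (@measurable_tnth _ _ _ j)).
have mWW : measurable (\bigcup_k W k) by exact: bigcup_measurable.
rewrite WE; split => //; apply/negligibleP => //.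
apply: negligible_bigcup => k; apply/negligibleP => //.
rewrite /W; case: insub => [j|]; last exact: measure0.
exact: tuple_measure_null_coordinate.
Qed.

End tuple_measure_integral.

(** * Lebesgue measure under scaling of the coordinates *)

Section lebesgue_scaling.
Local Open Scope classical_set_scope.
Local Open Scope ereal_scope.
Context (R : realType).

(** Packed as a measurable map so that its pushforward is recognised as a measure. *)
Let mulr_mfun (r : R) : {mfun measurableTypeR R >-> measurableTypeR R} :=
  HB.pack ( *%R r) (isMeasurableFun.Build _ _ (measurableTypeR R)
    (measurableTypeR R) ( *%R r) (mulrl_measurable r)).

(** By uniqueness of Lebesgue measure it suffices to compare both sides on intervals ]a, b], whose
    preimages are ]a/r, b/r]. *)
Lemma lebesgue_measure_scale (r : R) (A : set (measurableTypeR R)) :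
  (0 < r)%R -> measurable A ->
  lebesgue_measure A = r%:E * pushforward (@lebesgue_measure R) ( *%R r) A.
Proof.
move=> r0 mA.
have mr : measurable_fun setT ( *%R r : measurableTypeR R -> measurableTypeR R).
  exact: mulrl_measurable.
pose rn := NngNum (ltW r0).
rewrite (@lebesgue_measure_unique R
  (mscale rn (pushforward (@lebesgue_measure R) (mulr_mfun r))))//.
move=> X [[a b] _ <-] /=.
rewrite /mscale /= /pushforward.
rewrite (_ : _ @^-1` _ = `](a / r)%R, (b / r)%R]); last first.
  apply/seteqP; split => x /=; rewrite !in_itv/=;
    by rewrite ltr_pdivrMr// ler_pdivlMr// [(x * r)%R]mulrC.
rewrite !lebesgue_measure_itv/= !lte_fin ltr_pM2r ?invr_gt0//.
case: ifP => _; last by rewrite mule0.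
by rewrite -EFinD -EFinM; congr (_%:E); field; rewrite gt_eqF.
Qed.

Lemma ge0_integral_scale (r : R) (f : measurableTypeR R -> \bar R) :
  (0 < r)%R -> measurable_fun setT f -> (forall x, 0 <= f x) ->
  \int[lebesgue_measure]_x f (r * x)%R =
  r^-1%:E * \int[lebesgue_measure]_x f x.
Proof.
move=> r0 mf f0.
have mr : measurable_fun setT ( *%R r : measurableTypeR R -> measurableTypeR R).
  exact: mulrl_measurable.
pose rn := NngNum (ltW r0).
rewrite [in RHS](@eq_measure_integral _ _ _ _
  (mscale rn (pushforward (@lebesgue_measure R) (mulr_mfun r)))); last first.
  by move=> A mA _; rewrite [LHS](lebesgue_measure_scale r0).
rewrite ge0_integral_mscale//= ge0_integral_pushforward// preimage_setT/=.
by rewrite muleA -EFinM mulVf ?gt_eqF// mul1e.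
Qed.

(** Induction on n through the one-dimensional case. The factors may differ between coordinates
    because a Heisenberg dilation scales the last one by r^2. *)
Lemma ge0_integral_tuple_scale n (s : 'I_n -> R)
    (f : n.-tuple (measurableTypeR R) -> \bar R) :
  (forall i, 0 < s i)%R -> measurable_fun setT f -> (forall t, 0 <= f t) ->
  \int[tuple_measure (@lebesgue_measure R) n]_t
     f [tuple (s i * tnth t i)%R | i < n] =
  (\prod_(i < n) (s i)^-1)%:E *
  \int[tuple_measure (@lebesgue_measure R) n]_t f t.
Proof.
have mscale_tuple k (u : 'I_k -> R) : measurable_fun setT
    (fun t : k.-tuple (measurableTypeR R) =>
       [tuple (u i * tnth t i)%R | i < k] : k.-tuple (measurableTypeR R)).
  apply/measurable_fun_tnthP => i.
  rewrite (_ : _ \o _ = fun t => (u i * tnth t i)%R); last first.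
    by apply/funext => t /=; rewrite tnth_mktuple.
  by apply: measurable_funM => //; exact: measurable_tnth.
have mF k (g : k.+1.-tuple (measurableTypeR R) -> \bar R) :
    measurable_fun setT g -> (forall t, 0 <= g t) ->
    measurable_fun setT (fun x => \int[tuple_measure (@lebesgue_measure R) k]_t
      g (tcons (x, t))).
  move=> mg g0; apply: (measurable_fun_fubini_tonelli_F (fun z => g (tcons z))) => //.
  by apply: measurableT_comp => //; exact: measurable_tcons.
elim: n s f => [|n IHn] s f s0 mf f0.
  rewrite !integral_tuple_measure0//=; last exact: (measurableT_comp mf (mscale_tuple _ s)).
  by rewrite big_ord0 mul1e [X in f X = _]tuple0.
rewrite !integral_tuple_measureS//; last exact: (measurableT_comp mf (mscale_tuple _ s)).
under eq_integral => x _.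
  under eq_integral => t _.
    rewrite (_ : [tuple _ | i < n.+1] = tcons ((s ord0 * x)%R,
       [tuple (s (lift ord0 i) * tnth t i)%R | i < n])); last first.
      apply: eq_from_tnth => i; rewrite tnth_mktuple.
      by case: (unliftP ord0 i) => [j|] -> //; rewrite !tnthS tnth_mktuple.
    over.
  rewrite (IHn _ (fun t => f (tcons ((s ord0 * x)%R, t))))//; last first.
    apply: (measurableT_comp mf); apply: measurable_cons.
      exact: measurable_cst.
    exact: measurable_id.
  over.
rewrite ge0_integralZl; last 4 first.
- exact: measurableT.
- apply: (measurableT_comp (f := fun x => \int[tuple_measure _ n]_t f (tcons (x, t)))).
    exact: (mF _ f).
  exact: mulrl_measurable.
- by move=> x _; apply: integral_ge0.
- by rewrite lee_fin prodr_ge0// => i _; rewrite invr_ge0 ltW.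
rewrite (ge0_integral_scale (f := fun x => \int[tuple_measure _ n]_t f (tcons (x, t))))//; last 2 first.
- exact: (mF _ f).
- by move=> x; apply: integral_ge0.
rewrite big_ord_recl EFinM muleA; congr (_ * _).
by rewrite -EFinM mulrC.
Qed.

End lebesgue_scaling.

(** * Homogeneous norm, dilations and radial functions on the Heisenberg group *)

Section heisenberg_geometry.
Local Open Scope classical_set_scope.
Context (R : realType) (n : nat).
Local Notation heis := (heis R n).
Local Notation mu := (heis_measure R n).
Implicit Types (x y z : heis) (r s : R).

Lemma hnorm_ge0 x : 0 <= hnorm x.
Proof. exact: powR_ge0. Qed.

Lemma hdilation_tnth r x i : tnth (hdilation r x) i =
  (if i == ord_max then r ^+ 2 else r) * tnth x i.
Proof. by rewrite tnth_mktuple; case: ifP. Qed.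

(** Both summands under the fourth root acquire the factor r^4. *)
Lemma hnorm_dilation r x : 0 <= r -> hnorm (hdilation r x) = r * hnorm x.
Proof.
move=> r0; rewrite /hnorm hdilation_tnth eqxx.
under eq_bigr => i _.
  rewrite hdilation_tnth (_ : _ == ord_max = false); last first.
    by apply/negbTE; rewrite -val_eqE/= ltn_eqF.
  rewrite exprMn; over.
rewrite -mulr_sumr !(@exprMn _ 2 (r ^+ 2)) -mulrDr -exprM powRM; last 2 first.
- by rewrite exprn_ge0.
- by rewrite addr_ge0// sqr_ge0.
congr (_ * _); rewrite -powR_mulrn// -powRrM.
by rewrite mulfV// ?powRr1// pnatr_eq0.
Qed.

Lemma measurable_hnorm : measurable_fun setT (@hnorm R n).
Proof.
apply: (measurableT_comp (measurable_powR _)).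
apply: measurable_funD.
  apply: (measurableT_comp (exprn_measurable 2)).
  apply: measurable_sum => i.
  apply: (measurableT_comp (exprn_measurable 2)); exact: measurable_tnth.
apply: (measurableT_comp (exprn_measurable 2)); exact: measurable_tnth.
Qed.

Lemma measurable_hdilation d (T : measurableType d) (f : T -> R) (g : T -> heis) :
  measurable_fun setT f -> measurable_fun setT g ->
  measurable_fun setT (fun t => hdilation (f t) (g t)).
Proof.
move=> mf mg; apply/measurable_fun_tnthP => i.
rewrite (_ : _ \o _ =
  fun t => (if i == ord_max then f t ^+ 2 else f t) * tnth (g t) i); last first.
  by apply/funext => t /=; rewrite hdilation_tnth.
apply: measurable_funM.
  case: (i == ord_max) => //; exact: (measurableT_comp (exprn_measurable 2)).
exact: (measurableT_comp (measurable_tnth i)).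
Qed.

Local Open Scope ereal_scope.

(** The Jacobian has 2n factors r and one factor r^2, which gives the exponent Q = 2n + 2. *)
Lemma ge0_integral_hdilation r (f : heis -> \bar R) : (0 < r)%R ->
  measurable_fun setT f -> (forall x, 0 <= f x) ->
  \int[mu]_x f (hdilation r x) = (r ^- heis_dim n)%:E * \int[mu]_x f x.
Proof.
move=> r0 mf f0.
pose s (i : 'I_(2 * n).+1) := if i == ord_max then (r ^+ 2)%R else r.
transitivity (\int[mu]_x f [tuple (s i * tnth x i)%R | i < (2 * n).+1]).
  apply: eq_integral => x _; congr f.
  by apply: eq_from_tnth => i; rewrite hdilation_tnth tnth_mktuple.
rewrite ge0_integral_tuple_scale//; last first.
  by move=> i; rewrite /s; case: ifP => _; rewrite ?exprn_gt0.
congr (_%:E * _); rewrite big_ord_recr/= /s eqxx.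
under eq_bigr => i _.
  rewrite (_ : _ == ord_max = false); last first.
    by apply/negbTE; rewrite -val_eqE/= ltn_eqF.
  over.
by rewrite prodr_const card_ord -!exprVn -exprD.
Qed.

Lemma hnorm_eq0_measurable : measurable [set x : heis | hnorm x = 0%R].
Proof.
by apply: (@preimage_measurable _ _ _ _ (@hnorm R n) [set 0%R]);
  [exact: measurable_hnorm|exact: measurable_set1].
Qed.

(** A vanishing norm forces the last coordinate to vanish, and this hyperplane is null. *)
Lemma hnorm_eq0_null : mu [set x : heis | hnorm x = 0%R] = 0.
Proof.
apply/eqP; rewrite eq_le measure_ge0 andbT.
rewrite -(@tuple_measure_null_coordinate _ _ _ (@lebesgue_measure R)
  (2 * n).+1 ord_max [set 0%R] (measurable_set1 _) (lebesgue_measure_set1 _)).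
have mS : measurable [set x : heis | [set 0%R] (tnth x ord_max)].
  apply: (@preimage_measurable _ _ _ _ (fun x : heis => tnth x ord_max) [set 0%R]).
    exact: measurable_tnth.
  exact: measurable_set1.
apply: le_measure; rewrite ?inE//; first exact: hnorm_eq0_measurable.
move=> x /= /powR_eq0_eq0 /eqP; rewrite paddr_eq0 ?sqr_ge0//.
by move=> /andP[_]; rewrite sqrf_eq0 => /eqP.
Qed.

Lemma hnorm_gt0 x : hnorm x <> 0%R -> (0 < hnorm x)%R.
Proof. by move=> /eqP x0; rewrite lt0r x0 hnorm_ge0. Qed.

(** Used to pick a point outside a null set. *)
Lemma heis_measure_setT : mu setT != 0.
Proof.
rewrite (_ : setT = [set x : heis | forall i, [set: measurableTypeR R] (tnth x i)]).
  rewrite (@tuple_measureE _ _ _ _ _ (fun=> [set: measurableTypeR R]))//.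
  elim/big_rec : _ => [|i x _ x0]; first by rewrite onee_eq0.
  have : @lebesgue_measure R [set` `]-oo, +oo[%R] != 0.
    by rewrite lebesgue_measure_itv.
  by rewrite set_itvNyy => lT; exact: mule_neq0.
by apply/seteqP; split.
Qed.

Lemma heis_measure_preimage_hdilation r (M : set heis) : (0 < r)%R ->
  measurable M -> mu M = 0 -> mu (hdilation r @^-1` M) = 0.
Proof.
move=> r0 mM M0.
have mrM : measurable (hdilation r @^-1` M).
  apply: preimage_measurable => //.
  exact: (measurable_hdilation (measurable_cst r) (@measurable_id _ _ _)).
rewrite -[X in mu X]setIT -integral_indic//.
transitivity (\int[mu]_x (\1_M (hdilation r x))%:E) => //.
rewrite (ge0_integral_hdilation (f := fun x => (\1_M x)%:E))//.
- by rewrite integral_indic// setIT [X in _ * X]M0 mule0.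
- exact/measurable_EFinP.
Qed.

(* Fubini: the set of all (x, z) with delta_|x| z in M is null. *)
Lemma exists_null_orbit (M : set heis) : measurable M -> mu M = 0 ->
  exists z, (0 < hnorm z)%R /\ mu [set x | M (hdilation (hnorm x) z)] = 0.
Proof.
move=> mM M0.
pose F (p : heis * heis) := (\1_M (hdilation (hnorm p.1) p.2))%:E : \bar R.
have mD : measurable_fun setT (fun p : heis * heis => hdilation (hnorm p.1) p.2).
  apply: measurable_hdilation; last exact: measurable_snd.
  exact: (measurableT_comp measurable_hnorm).
have mF : measurable_fun setT F.
  by apply/measurable_EFinP; apply: measurableT_comp.
have F0 p : 0 <= F p by rewrite lee_fin.
(* With the order of integration exchanged, the section at a fixed x of positive norm is the
   preimage of M under a dilation, hence null. *)
have I0 : \int[mu]_z \int[mu]_x F (x, z) = 0.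
  rewrite -fubini_tonelli//.
  rewrite (@eq_integral_off_null _ _ _ _ [set x : heis | hnorm x = 0%R] _ (cst 0)).
  - by rewrite integral0.
  - exact: hnorm_eq0_measurable.
  - exact: hnorm_eq0_null.
  move=> x /= /hnorm_gt0 x0.
  transitivity (\int[mu]_z (\1_M (hdilation (hnorm x) z))%:E) => //.
  rewrite (ge0_integral_hdilation (f := fun x => (\1_M x)%:E))//.
    by rewrite integral_indic// setIT [X in _ * X]M0 mule0.
  exact/measurable_EFinP.
have mG : measurable_fun setT (fun z => \int[mu]_x F (x, z)).
  exact: measurable_fun_fubini_tonelli_G.
have /(ae_eq_integral_abs mu measurableT mG)[N [mN N0 HN]] :
    \int[mu]_z `|\int[mu]_x F (x, z)| = 0.
  rewrite -[RHS]I0; apply: eq_integral => z _.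
  by rewrite gee0_abs// integral_ge0.
(* Otherwise the whole space would be a union of two null sets. *)
have [z Hz] : exists z, ~ (N `|` [set x : heis | hnorm x = 0%R]) z.
  apply/existsNP => NT.
  have : mu setT = 0.
    apply/eqP; rewrite eq_le measure_ge0 andbT.
    rewrite (_ : setT = N `|` [set x : heis | hnorm x = 0%R]).
      have mZ := hnorm_eq0_measurable.
      apply: (le_trans (measureU2 _ mN mZ)).
      by rewrite [X in X + _]N0 [X in _ + X]hnorm_eq0_null adde0.
    by apply/seteqP; split.
  by move/eqP; rewrite (negbTE heis_measure_setT).
move/not_orP : Hz => [Nz /hnorm_gt0 z0].
exists z; split => //.
have : \int[mu]_x F (x, z) = 0 by apply: contrapT => Fz; apply: Nz; apply: HN => /(_ I).
have mS : measurable [set x : heis | M (hdilation (hnorm x) z)].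
  exact: (preimage_measurable
    (measurable_hdilation measurable_hnorm (measurable_cst z)) mM).
by rewrite -[X in mu X]setIT -integral_indic.
Qed.

(* The Borel version is read off along the orbit of one point z that meets the
   exceptional set only at a null set of radii; this makes it radial. *)
Lemma radial_version (f : heis -> R) :
  completed_measurable_fun mu f -> radial f ->
  exists g M, [/\ measurable M, mu M = 0, measurable_fun setT g, radial g &
    forall x, ~ M x -> f x = g x].
Proof.
move=> mf rf; have [M [mM M0 mg]] := completed_version mf.
set f0 := (fun x => _) in mg.
have [z [z0 Sz]] := exists_null_orbit mM M0.
pose S := [set x : heis | M (hdilation (hnorm x) z)].
have mS : measurable S.
  exact: (preimage_measurable
    (measurable_hdilation measurable_hnorm (measurable_cst z)) mM).
(* The point of the orbit of z with the same norm as x stands in for x. *)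
exists (fun x => f0 (hdilation (hnorm x / hnorm z) z)).
(* These are the x whose representative on the orbit falls into M. *)
exists (hdilation (hnorm z)^-1 @^-1` S); split.
- apply: preimage_measurable => //.
  exact: (measurable_hdilation (measurable_cst _) (@measurable_id _ _ _)).
- by apply: heis_measure_preimage_hdilation => //; rewrite invr_gt0.
- apply: (measurableT_comp mg); apply: measurable_hdilation => //.
  apply: measurable_funM => //; exact: measurable_hnorm.
- by move=> x y ->.
- move=> x; rewrite /S/= hnorm_dilation ?invr_ge0 ?hnorm_ge0// mulrC => Mx.
  rewrite /f0 memNset//; apply: rf.
  rewrite hnorm_dilation; last by rewrite divr_ge0 ?hnorm_ge0.
  by rewrite divfK// gt_eqF.
Qed.

(** Both points have norm |x|_h |y|_h. The exchange makes x the dilated variable, so that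
    integration in x can use the scaling of Haar measure. *)
Lemma radial_hdilationC (f : heis -> R) x y : radial f ->
  f (hdilation (hnorm x) y) = f (hdilation (hnorm y) x).
Proof.
by move=> rf; apply: rf; rewrite !hnorm_dilation ?hnorm_ge0// mulrC.
Qed.

End heisenberg_geometry.

(** * Weighted AM-GM and a Jensen inequality *)

Section weighted_inequalities.
Local Open Scope classical_set_scope.
Context (R : realType).

Lemma prod_powR_le_sum (I : finType) (t a : I -> R) :
  (forall i, 0 < t i) -> \sum_i t i = 1 -> (forall i, 0 <= a i) ->
  \prod_i a i `^ t i <= \sum_i t i * a i.
Proof.
move=> t0 t1 a0.
have S0 : 0 <= \sum_i t i * a i.
  by apply: sumr_ge0 => i _; rewrite mulr_ge0// ltW.
have [/forallP agt0|] := boolP [forall i, 0 < a i]; last first.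
  rewrite negb_forall => /existsP[i]; rewrite -leNgt => ai0.
  have -> : \prod_i a i `^ t i = 0; last by [].
  apply/eqP; rewrite prodf_seq_eq0.
  apply/hasP; exists i; first by rewrite mem_index_enum.
  have /eqP ai : a i == 0 by rewrite eq_le ai0 a0.
  by rewrite /= ai powR0 ?eqxx// gt_eqF.
(* The index set is nonempty because the weights sum to 1; this makes the mean A positive. *)
have [i0 _] : exists i0 : I, true.
  apply/existsP; apply: contraT; rewrite negb_exists => /forallP no.
  by move: t1; rewrite big1 => [/eqP|i]; [rewrite eq_sym oner_eq0|have := no i].
set A := \sum_i _.
have A0 : 0 < A.
  rewrite /A (bigD1 i0)//= ltr_pwDl ?mulr_gt0//.
  by apply: sumr_ge0 => i _; rewrite mulr_ge0// ltW.
under eq_bigr => i _ do rewrite /powR gt_eqF//.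
rewrite -expR_sum -ler_ln ?posrE ?expR_gt0// expRK.
(* This is ln u <= u - 1 at u = a i / A. The corrections a i / A - 1 average to 0. *)
apply: (@le_trans _ _ (\sum_i t i * (ln A + (a i / A - 1)))).
  apply: ler_sum => i _; rewrite ler_pM2l// -lerBlDl -ln_div ?posrE//.
  rewrite -[X in ln X](subrK 1) addrC; apply: le_ln1Dx.
  by rewrite -subr_gt0 opprK subrK divr_gt0.
under eq_bigr => i _ do rewrite mulrDr mulrBr mulr1 mulrA.
by rewrite big_split/= sumrB -!mulr_suml t1 mul1r divff ?gt_eqF// subrr addr0.
Qed.

Local Open Scope ereal_scope.

(** Hoelder with exponents q/(q - 1) and q for the factorisation w P = w^(1 - 1/q) (w^(1/q) P),
    raised to the power q. *)
Lemma weighted_jensen d (T : measurableType d)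
    (mu : {measure set T -> \bar R}) (q : R) (w P : T -> R) : (1 < q)%R ->
  measurable_fun setT w -> measurable_fun setT P ->
  (forall x, 0 <= w x)%R -> (forall x, 0 <= P x)%R ->
  (\int[mu]_x (w x * P x)%:E) `^ q <=
  (\int[mu]_x (w x)%:E) `^ (q - 1) * \int[mu]_x (w x * P x `^ q)%:E.
Proof.
move=> q1 mw mP w0 P0.
have q0 : (0 < q)%R by apply: lt_trans q1.
pose r := (1 - q^-1)%R.
have r0 : (0 < r)%R by rewrite subr_gt0 invf_lt1.
pose f x := (w x `^ r)%R; pose g x := (w x `^ q^-1 * P x)%R.
have mf : measurable_fun setT f by exact: (measurableT_comp (measurable_powR _)).
have mg : measurable_fun setT g.
  by apply: measurable_funM => //; exact: (measurableT_comp (measurable_powR _)).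
have fg x : (f x * g x = w x * P x)%R.
  rewrite /f /g mulrA -powRD; first by rewrite subrK powRr1.
  by rewrite subrK oner_eq0.
have r1 : (r^-1^-1 + q^-1 = 1)%R by rewrite invrK subrK.
have := hoelder mu mf mg (p := r^-1) (q := q).
rewrite invr_gt0 => /(_ r0 q0 r1).
rewrite Lnorm1.
under eq_integral => x _.
  rewrite /= fg ger0_norm; last exact: mulr_ge0.
  over.
move=> H.
have := @gt0_ler_poweR R q (ltW q0) _ _ _ _ H.
rewrite !in_itv/= !leey !andbT.
set I := integral _ _ _ in H *.
have I0 : 0 <= I by apply: integral_ge0 => x _; rewrite lee_fin mulr_ge0.
rewrite I0 mule_ge0 ?Lnorm_ge0// => /(_ isT isT) /le_trans; apply.
rewrite poweRM ?Lnorm_ge0// poweR_Lnorm ?gt_eqF//.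
have -> : (q - 1 = r * q)%R by rewrite mulrBl mul1r mulVf// gt_eqF.
rewrite poweRrM (_ : 'N[mu]_(r^-1)%:E[EFin \o f] = (\int[mu]_x (w x)%:E) `^ r).
  apply: lee_pmul => //; [exact: poweR_ge0| |].
    by apply: integral_ge0 => x _; exact: poweR_ge0.
  rewrite le_eqVlt; apply/orP; left; apply/eqP; apply: eq_integral => x _.
  rewrite /= ger0_norm ?mulr_ge0 ?powR_ge0//.
  by rewrite powRM ?powR_ge0// -powRrM mulVf ?gt_eqF// powRr1.
rewrite unlock invrK; congr (_ `^ _); apply: eq_integral => x _.
by rewrite /= ger0_norm ?powR_ge0// -powRrM divff ?gt_eqF// powRr1.
Qed.

End weighted_inequalities.

(** * Upper bound for Borel data *)

Section hausdorff_upper_bound.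
Local Open Scope classical_set_scope.

Lemma powR_prod (R : realType) (I : Type) (s : seq I) (a : I -> R) (p : R) :
  (forall i, 0 <= a i) -> (\prod_(i <- s) a i) `^ p = \prod_(i <- s) a i `^ p.
Proof.
move=> a0; elim: s => [|i s IH]; first by rewrite !big_nil powR1.
by rewrite !big_cons powRM ?IH// prodr_ge0.
Qed.

Lemma powR_sum (R : realType) (I : Type) (s : seq I) (a : R) (p : I -> R) :
  0 < a -> a `^ (\sum_(i <- s) p i) = \prod_(i <- s) a `^ p i.
Proof.
move=> a0; elim: s => [|i s IH]; first by rewrite !big_nil powRr0.
by rewrite !big_cons powRD ?IH// (lt0r_neq0 a0) implybT.
Qed.

(* This identity dictates the exponents of |y_j|_h in C^h. *)
Lemma powR_dilation_weight (R : realType) (v x y q p al D : R) :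
  0 <= v -> 0 < x -> 0 < y -> 0 < q -> 0 < p ->
  (v * y `^ (- (- (al / q) - D / p))) `^ q * x `^ al =
  (v `^ p * (y * x) `^ (p * al / q) * y `^ D) `^ (q / p).
Proof.
move=> v0 x0 y0 q0 p0.
rewrite (powRM (p * al / q) (ltW y0) (ltW x0)).
rewrite (powRM (q / p) _ (powR_ge0 _ _)) ?mulr_ge0 ?powR_ge0//.
rewrite (powRM (q / p) (powR_ge0 _ _)) ?mulr_ge0 ?powR_ge0//.
rewrite (powRM (q / p) (powR_ge0 _ _) (powR_ge0 _ _)).
rewrite (powRM q v0 (powR_ge0 _ _)) -!powRrM.
have pN0 : p != 0 by rewrite gt_eqF.
have qN0 : q != 0 by rewrite gt_eqF.
rewrite (_ : - (- (al / q) - D / p) * q = al + D * (q / p)); last first.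
  by field; rewrite pN0.
rewrite powRD; last by rewrite (lt0r_neq0 y0) implybT.
rewrite (_ : p * (q / p) = q); last by field.
rewrite (_ : p * al / q * (q / p) = al); last by field; rewrite pN0.
by ring.
Qed.

Context (R : realType) (n m : nat).
Local Notation heis := (heis R n).
Local Notation mu := (heis_measure R n).
Local Notation mum := (tuple_measure mu m).

(** Off this null set the powers of |y_j|_h obey the usual laws; at 0, [powR] with a nonzero
    exponent takes the value 0. *)
Definition hnorm_zero : set (m.-tuple heis) :=
  [set y | exists j, hnorm (tnth y j) = 0].

Lemma hnorm_zero_null : measurable hnorm_zero /\ mum hnorm_zero = 0%E.
Proof.
apply: (tuple_measure_null_coordinates (Z := fun=> [set x : heis | hnorm x = 0])) => _.
  exact: hnorm_eq0_measurable.
exact: hnorm_eq0_null.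
Qed.

Lemma not_hnorm_zero y : ~ hnorm_zero y -> forall j, 0 < hnorm (tnth y j).
Proof. by move=> yZ j; apply: hnorm_gt0 => yj; apply: yZ; exists j. Qed.

Context (q alpha : R) (qs alphas : 'I_m -> R) (K : m.-tuple heis -> R).
Hypotheses (q_gt1 : 1 < q) (qs_gt1 : forall j, 1 < qs j)
  (qE : q^-1 = \sum_(j < m) (qs j)^-1) (alphaE : alpha = \sum_(j < m) alphas j)
  (K_ge0 : forall y, 0 <= K y) (mK : measurable_fun setT K).
Context (f : 'I_m -> heis -> R).
Hypotheses (mf : forall j, measurable_fun setT (f j)) (rf : forall j, radial (f j)).

Local Notation dim := (heis_dim n).
Local Notation a j := (- (alphas j / q) - dim%:R / qs j).

Let q_gt0 : 0 < q. Proof. exact: lt_trans q_gt1. Qed.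
Let qs_gt0 j : 0 < qs j. Proof. exact: lt_trans (qs_gt1 j). Qed.

(** [wt] is the integrand of C^h, and [P] undoes its powers of the norms, so that off [hnorm_zero]
    their product is the absolute value of the integrand of H^h(f). [F j] is the integrand of the
    q_j-th power of the norm of f_j. *)
Let wt (y : m.-tuple heis) := K y * \prod_(j < m) hnorm (tnth y j) `^ a j.
Let P (x : heis) (y : m.-tuple heis) := \prod_(j < m)
  (`|f j (hdilation (hnorm x) (tnth y j))| * hnorm (tnth y j) `^ (- a j)).
Let F j (x : heis) := `|f j x| `^ qs j * hnorm x `^ (qs j * alphas j / q).

Context (B : 'I_m -> R).
Hypotheses (B_gt0 : forall j, 0 < B j)
  (FE : forall j, (\int[mu]_x (F j x)%:E = (B j)%:E)%E).

(** The AM-GM mean with weights q/q_j. The factor |y_j|_h^Q / B_j makes each averaged term integrate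
    to 1 in x when |y_j|_h > 0. *)
Let S (x : heis) (y : m.-tuple heis) := \sum_(j < m) q / qs j *
  ((F j (hdilation (hnorm (tnth y j)) x) * hnorm (tnth y j) ^+ dim) / B j).

Let wt_ge0 y : 0 <= wt y.
Proof. by rewrite mulr_ge0// prodr_ge0// => j _; rewrite powR_ge0. Qed.

Let P_ge0 x y : 0 <= P x y.
Proof. by rewrite prodr_ge0// => j _; rewrite mulr_ge0// powR_ge0. Qed.

Let F_ge0 j x : 0 <= F j x.
Proof. by rewrite mulr_ge0// powR_ge0. Qed.

Let S_ge0 x y : 0 <= S x y.
Proof.
apply: sumr_ge0 => j _.
apply: mulr_ge0; apply: divr_ge0; try by apply: ltW.
by rewrite mulr_ge0// exprn_ge0// hnorm_ge0.
Qed.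

Let prod_dilated_le x y : 0 < hnorm x -> (forall j, 0 < hnorm (tnth y j)) ->
  P x y `^ q * hnorm x `^ alpha <= \prod_(j < m) B j `^ (q / qs j) * S x y.
Proof.
move=> x0 y0.
rewrite /P powR_prod; last by move=> j; rewrite mulr_ge0// powR_ge0.
rewrite alphaE powR_sum// -big_split/=.
pose G j := (F j (hdilation (hnorm (tnth y j)) x) * hnorm (tnth y j) ^+ dim) / B j.
have G0 j : 0 <= G j.
  by apply: divr_ge0; [rewrite mulr_ge0// exprn_ge0// hnorm_ge0|exact: ltW].
(* The constants B_j are taken out before AM-GM: for the normalised terms it loses nothing after
   integration in x. *)
rewrite (eq_bigr (fun j => B j `^ (q / qs j) * G j `^ (q / qs j))).
  rewrite big_split/= ler_wpM2l//.
    by apply: prodr_ge0 => j _; exact: powR_ge0.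
  apply: prod_powR_le_sum => // [j|]; first by rewrite divr_gt0.
  by rewrite -mulr_sumr -qE divff// gt_eqF.
move=> j _; rewrite -powRM//; last exact: ltW.
rewrite /G [B j * _]mulrC divfK; last by rewrite gt_eqF.
rewrite (radial_hdilationC x) // /F hnorm_dilation ?hnorm_ge0//.
rewrite -powR_mulrn ?hnorm_ge0//.
exact: powR_dilation_weight.
Qed.

Let mhnorm j : measurable_fun setT (fun y : m.-tuple heis => hnorm (tnth y j)).
Proof. by apply: (measurableT_comp (@measurable_hnorm R n)); exact: measurable_tnth. Qed.

Let mwt : measurable_fun setT wt.
Proof.
apply: measurable_funM => //; apply: measurable_prod => j _.
exact: (measurableT_comp (measurable_powR _)).
Qed.

Let mP x : measurable_fun setT (P x).
Proof.
apply: measurable_prod => j _; apply: measurable_funM.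
  apply: measurableT_comp => //; apply: (measurableT_comp (mf j)).
  by apply: measurable_hdilation => //; exact: measurable_tnth.
exact: (measurableT_comp (measurable_powR _)).
Qed.

Let mF j : measurable_fun setT (F j).
Proof.
apply: measurable_funM.
  apply: (measurableT_comp (measurable_powR _)).
  exact: measurableT_comp.
apply: (measurableT_comp (measurable_powR _)); exact: measurable_hnorm.
Qed.

Let mS : measurable_fun setT (fun p : heis * m.-tuple heis => S p.1 p.2).
Proof.
apply: measurable_sum => j; apply: measurable_funM => //.
have mh : measurable_fun setT (fun p : heis * m.-tuple heis => hnorm (tnth p.2 j)).
  exact: (measurableT_comp (mhnorm j)).
apply: measurable_funM => //; apply: measurable_funM.
  by apply: (measurableT_comp (mF j)); apply: measurable_hdilation.
exact: (measurableT_comp (exprn_measurable _)).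
Qed.

Local Open Scope ereal_scope.

Let le_abse_hausdorff x : `|hausdorff K f x| <= \int[mum]_y (wt y * P x y)%:E.
Proof.
have mfx j : measurable_fun setT
    (fun y : m.-tuple heis => f j (hdilation (hnorm x) (tnth y j))).
  apply: (measurableT_comp (mf j)); apply: measurable_hdilation => //.
  exact: measurable_tnth.
apply: le_trans (le_abse_integral _ measurableT _) _.
  apply/measurable_EFinP; apply: measurable_funM => //.
  by apply: measurable_prod => j _.
have [mZ Z0] := hnorm_zero_null.
apply: (le_integral_off_null mZ Z0) => [y|y|y /not_hnorm_zero y0].
- exact: abse_ge0.
- by rewrite lee_fin mulr_ge0.
rewrite /= lee_fin normrM normr_prod ger0_norm// /wt /P -mulrA ler_wpM2l//.
rewrite -big_split/=; apply: ler_prod => j _; rewrite normr_ge0/=.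
rewrite mulrCA -powRD; last by rewrite (lt0r_neq0 (y0 j)) implybT.
by rewrite subrr powRr0 mulr1.
Qed.

Local Notation C := (hausdorff_const K q qs alphas).
Local Notation beta := (\prod_(j < m) B j `^ (q / qs j))%R.

Let beta_ge0 : (0 <= beta)%R.
Proof. by apply: prodr_ge0 => j _; exact: powR_ge0. Qed.

(** Jensen with weight [wt], followed by AM-GM under the y-integral. *)
Let hausdorff_pointwise_le x : (0 < hnorm x)%R ->
  `|hausdorff K f x| `^ q * (hnorm x `^ alpha)%:E <=
  C `^ (q - 1) * \int[mum]_y (beta * (wt y * S x y))%:E.
Proof.
move=> x0.
apply: (@le_trans _ _ ((C `^ (q - 1) * \int[mum]_y (wt y * P x y `^ q)%:E) *
  (hnorm x `^ alpha)%:E)).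
  apply: lee_wpmul2r; first by rewrite lee_fin powR_ge0.
  apply: le_trans (weighted_jensen mum q_gt1 mwt (mP x) wt_ge0 (P_ge0 x)).
  apply: gt0_ler_poweR; rewrite ?in_itv/= ?leey ?andbT ?abse_ge0 ?(ltW q_gt0)//.
  by apply: integral_ge0 => y _; rewrite lee_fin mulr_ge0.
rewrite -muleA; apply: lee_wpmul2l; first exact: poweR_ge0.
rewrite muleC -ge0_integralZl_EFin; last 4 first.
- exact: measurableT.
- by move=> y _; rewrite lee_fin mulr_ge0 ?powR_ge0.
- apply/measurable_EFinP; apply: measurable_funM => //.
  exact: (measurableT_comp (measurable_powR _)).
- exact: powR_ge0.
have [mZ Z0] := hnorm_zero_null.
apply: (le_integral_off_null mZ Z0) => [y|y|y /not_hnorm_zero y0].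
- by rewrite -EFinM lee_fin mulr_ge0 ?powR_ge0// mulr_ge0// powR_ge0.
- by rewrite lee_fin mulr_ge0// mulr_ge0.
rewrite -EFinM lee_fin mulrCA [leRHS]mulrCA ler_wpM2l// mulrC.
exact: prod_dilated_le.
Qed.

(** The Jacobian |y_j|_h^(-Q) and the integral B_j cancel the normalisation in [S], and the weights
    q/q_j sum to 1. *)
Let integral_dilates y : (forall j, 0 < hnorm (tnth y j))%R ->
  \int[mu]_x (beta * (wt y * S x y))%:E = (beta * wt y)%:E.
Proof.
move=> y0.
pose k j := (beta * wt y * (q / qs j) * (hnorm (tnth y j) ^+ dim / B j))%R.
have k0 j : (0 <= k j)%R.
  apply: mulr_ge0; last by rewrite divr_ge0 ?exprn_ge0 ?hnorm_ge0// ltW.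
  by apply: mulr_ge0; [exact: mulr_ge0|rewrite divr_ge0// ltW].
transitivity (\int[mu]_x \sum_(j < m)
    ((k j)%:E * (F j (hdilation (hnorm (tnth y j)) x))%:E)).
  apply: eq_integral => x _; rewrite sumEFin; congr (_%:E).
  rewrite mulrA mulr_sumr; apply: eq_bigr => j _; rewrite /k.
  by rewrite !mulrA; ring.
have mFd j : measurable_fun setT
    (fun x : heis => (F j (hdilation (hnorm (tnth y j)) x))%:E).
  apply/measurable_EFinP; apply: (measurableT_comp (mF j)).
  exact: measurable_hdilation.
rewrite ge0_integral_sum//; last 2 first.
- by move=> j; exact: measurable_funeM.
- by move=> j x _; rewrite -EFinM lee_fin mulr_ge0.
transitivity (\sum_(j < m) ((beta * wt y) * (q / qs j))%:E).
  apply: eq_bigr => j _; rewrite ge0_integralZl_EFin//; last first.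
    by move=> x _; rewrite lee_fin.
  rewrite (ge0_integral_hdilation (f := fun x => (F j x)%:E))//; last 2 first.
  - exact/measurable_EFinP.
  - by move=> x; rewrite lee_fin.
  rewrite FE -!EFinM; congr (_%:E); rewrite /k.
  have := y0 j; move: (hnorm _) => Y Y0; have BN0 : B j != 0%R by rewrite gt_eqF.
  have : (Y ^+ dim != 0)%R by rewrite expf_neq0// gt_eqF.
  by move: (_ ^+ dim)%R => Yd Yd0; field; rewrite Yd0 BN0 gt_eqF.
rewrite sumEFin -mulr_sumr -mulr_sumr -qE divff ?mulr1// gt_eqF//.
Qed.

(** The pointwise bound is integrated in x and Tonelli is applied; the y-integral of [wt] supplies
    the last factor of C^h. The q-th root of the product of the B_j^(q/q_j) is the product of the
    norms. *)
Lemma integral_hausdorff_le :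
  \int[mu]_x (`|hausdorff K f x| `^ q * (hnorm x `^ alpha)%:E) <=
  C `^ q * beta%:E.
Proof.
pose G (p : heis * m.-tuple heis) := (beta * (wt p.2 * S p.1 p.2))%:E.
have mG : measurable_fun setT G.
  apply/measurable_EFinP; apply: measurable_funM; first exact: measurable_cst.
  apply: measurable_funM; last exact: mS.
  exact: (measurableT_comp mwt measurable_snd).
have G0 p : 0 <= G p by rewrite lee_fin mulr_ge0// mulr_ge0.
apply: (@le_trans _ _ (\int[mu]_x (C `^ (q - 1) * \int[mum]_y G (x, y)))).
  apply: (le_integral_off_null (@hnorm_eq0_measurable R n) (@hnorm_eq0_null R n))
    => [x|x|x /hnorm_gt0 x0].
  - by rewrite mule_ge0 ?poweR_ge0// lee_fin powR_ge0.
  - by rewrite mule_ge0 ?poweR_ge0// integral_ge0.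
  - exact: hausdorff_pointwise_le.
rewrite ge0_integralZl; last 4 first.
- exact: measurableT.
- exact: measurable_fun_fubini_tonelli_F.
- by move=> x _; exact: integral_ge0.
- exact: poweR_ge0.
rewrite fubini_tonelli//.
have [mZ Z0] := hnorm_zero_null.
rewrite (eq_integral_off_null (g := fun y => (beta%:E * (wt y)%:E)) mZ Z0); last first.
  by move=> y /not_hnorm_zero y0; rewrite -EFinM -integral_dilates.
rewrite ge0_integralZl_EFin//; last first.
- exact/measurable_EFinP.
- by move=> y _; rewrite lee_fin.
rewrite -[integral _ _ _]/C muleCA [leLHS]muleC.
have -> : C `^ (q - 1) * C = C `^ q; last by [].
have C0 : 0 <= C by apply: integral_ge0 => y _; rewrite lee_fin; exact: wt_ge0.
rewrite -[X in _ * X]poweRe1// -poweRD ?subrK//.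
by rewrite poweRD_defE subrK gt_eqF.
Qed.

End hausdorff_upper_bound.

(** * Masses of shells for the dilation-invariant density *)

Section shells.
Local Open Scope classical_set_scope.
Context (R : realType) (n : nat).
Local Notation heis := (heis R n).
Local Notation mu := (heis_measure R n).
Local Notation dim := (heis_dim n).
Implicit Types (s t u r : R) (x : heis).

(** The measure |x|_h^(-Q) dx is invariant under dilations, as dr/r is on the half-line. *)
Definition shell s t x : R := if s <= hnorm x < t then hnorm x ^- dim else 0.

Lemma shell_ge0 s t x : 0 <= shell s t x.
Proof. by rewrite /shell; case: ifP => // _; rewrite invr_ge0 exprn_ge0 ?hnorm_ge0. Qed.

Lemma measurable_shell_cond d (T : measurableType d) (h : T -> R) s t :
  measurable_fun setT h -> measurable [set p | s <= h p < t].
Proof.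
move=> mh; rewrite (_ : [set p | _] = h @^-1` `[s, t[%classic).
  exact: (preimage_measurable mh (measurable_itv _)).
by apply/seteqP; split => p /=; rewrite in_itv.
Qed.

Lemma measurable_if_set d (T : measurableType d) (b : T -> bool) (g : T -> R) :
  measurable [set p | b p] -> measurable_fun setT g ->
  measurable_fun setT (fun p => if b p then g p else 0).
Proof.
move=> mb mg; rewrite (_ : (fun p => _) = fun p => \1_[set p | b p] p * g p).
  by apply: measurable_funM => //; exact: measurable_indic.
apply/funext => p; rewrite indicE; case: ifPn => bx.
  by rewrite mem_set// mul1r.
by rewrite memNset ?mul0r//=; exact/negP.
Qed.

Lemma measurable_shell s t : measurable_fun setT (shell s t).
Proof.
apply: measurable_if_set.
  by apply: measurable_shell_cond; exact: measurable_hnorm.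
rewrite (_ : (fun x => _) = fun x => hnorm x `^ (- dim%:R)).
  by apply: (measurableT_comp (measurable_powR _)); exact: measurable_hnorm.
by apply/funext => x; rewrite powR_invn// hnorm_ge0.
Qed.

Local Open Scope ereal_scope.

Lemma integral_shell_dilation r s t : (0 < r)%R ->
  \int[mu]_x (shell (r * s) (r * t) x)%:E = \int[mu]_x (shell s t x)%:E.
Proof.
move=> r0.
have rd : (r ^+ dim != 0)%R by rewrite expf_neq0// gt_eqF.
have := ge0_integral_hdilation (f := fun x => (shell (r * s) (r * t) x)%:E) r0.
rewrite (eq_integral (fun x => (r ^- dim)%:E * (shell s t x)%:E)); last first.
  move=> x _; rewrite -EFinM /shell hnorm_dilation ?(ltW r0)//.
  rewrite ler_pM2l// ltr_pM2l//; case: ifP => _; last by rewrite mulr0.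
  by rewrite exprMn invfM.
rewrite ge0_integralZl_EFin//; last 3 first.
- by move=> x _; rewrite lee_fin shell_ge0.
- by apply/measurable_EFinP; exact: measurable_shell.
- by rewrite invr_ge0 exprn_ge0// ltW.
move=> /(_ _ _)/(congr1 (fun z => (r ^+ dim)%:E * z)).
rewrite !muleA -EFinM divff// !mul1e => -> //.
- by apply/measurable_EFinP; exact: measurable_shell.
- by move=> x; rewrite lee_fin shell_ge0.
Qed.

Lemma integral_shellD s t u : (s <= t <= u)%R ->
  \int[mu]_x (shell s u x)%:E =
  \int[mu]_x (shell s t x)%:E + \int[mu]_x (shell t u x)%:E.
Proof.
move=> /andP[st tu]; rewrite -ge0_integralD//.
- apply: eq_integral => x _; rewrite -EFinD; congr (_%:E); rewrite /shell.
  case: (leP s (hnorm x)) => sx /=; last first.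
    by rewrite leNgt (lt_le_trans sx st)/= addr0.
  case: (leP t (hnorm x)) => tx /=; first by rewrite add0r.
  by rewrite (lt_le_trans tx tu) addr0.
- by move=> x _; rewrite lee_fin shell_ge0.
- by apply/measurable_EFinP; exact: measurable_shell.
- by move=> x _; rewrite lee_fin shell_ge0.
- by apply/measurable_EFinP; exact: measurable_shell.
Qed.

(** The region splits into k shells of ratio r, all dilates of the first and hence of equal mass. *)
Lemma integral_shell_exp r i k : (1 <= r)%R ->
  \int[mu]_x (shell (r ^+ i) (r ^+ (i + k)) x)%:E =
  k%:R%:E * \int[mu]_x (shell 1 r x)%:E.
Proof.
move=> r1; have r0 : (0 < r)%R by exact: lt_le_trans r1.
elim: k => [|k IH].
  rewrite addn0 mul0e; apply: integral0_eq => x _.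
  by rewrite /shell; case: ifP => // /andP[a /le_lt_trans -/(_ _ a)]; rewrite ltxx.
rewrite (@integral_shellD _ (r ^+ (i + k))%R).
  have -> : shell (r ^+ (i + k)) (r ^+ (i + k.+1)) =
      shell (r ^+ (i + k) * 1) (r ^+ (i + k) * r).
    by rewrite mulr1 addnS exprSr.
  rewrite IH.
  rewrite integral_shell_dilation ?exprn_gt0//.
  by rewrite -natr1 EFinD ge0_muleDl ?mul1e// lee_fin.
by rewrite !ler_weXn2l// ?leq_addr// addnS.
Qed.

Definition box (s t : 'I_(2 * n).+1 -> R) : set heis :=
  [set x | forall i, s i <= tnth x i <= t i]%R.

Lemma measurable_box (s t : 'I_(2 * n).+1 -> R) : measurable (box s t).
Proof.
rewrite (_ : box s t = \bigcap_(i : 'I_(2 * n).+1)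
    ((fun x : heis => tnth x i) @^-1` `[s i, t i]%classic)).
  apply: fin_bigcap_measurable => // i _.
  exact: (preimage_measurable (@measurable_tnth _ _ _ i)).
apply/seteqP; split => x /= bx i.
  by move=> _; rewrite /= in_itv; exact: bx.
by have := bx i I; rewrite /= in_itv.
Qed.

Lemma heis_measure_box (s t : 'I_(2 * n).+1 -> R) : (forall i, s i <= t i)%R ->
  mu (box s t) = (\prod_i (t i - s i))%:E.
Proof.
move=> st; rewrite -prodEFin.
have mI i : measurable (`[s i, t i]%classic : set (measurableTypeR R)).
  exact: measurable_itv.
transitivity (\prod_(i < (2 * n).+1)
    lebesgue_measure (`[s i, t i]%classic : set (measurableTypeR R))).
  rewrite -(tuple_measureE (@lebesgue_measure R) mI).
  suff -> : box s t = [set x : heis | forall i, `[s i, t i]%classic (tnth x i)] by [].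
  by apply/seteqP; split => x /= bx i; have := bx i; rewrite /= in_itv.
apply: eq_bigr => i _; rewrite lebesgue_measure_itv/= lte_fin -EFinD.
by case: ltP => // ts; rewrite (le_anti (introT andP (conj (st i) ts))) subrr.
Qed.

Lemma hnorm_exp4 x : (hnorm x ^+ 4 =
  (\sum_(i < 2 * n) tnth x (widen_ord (leqnSn (2 * n)) i) ^+ 2) ^+ 2
    + tnth x ord_max ^+ 2)%R.
Proof.
rewrite -powR_mulrn ?hnorm_ge0// /hnorm -powRrM mulVf ?pnatr_eq0//.
by rewrite powRr1// addr_ge0// sqr_ge0.
Qed.

(** On the shell the density is at most 1, and the shell lies in a cube: the last coordinate is
    bounded by r^2, the others by r <= r^2. *)
Lemma integral_shell_lty r : (1 <= r)%R -> \int[mu]_x (shell 1 r x)%:E < +oo.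
Proof.
move=> r1; have r0 : (0 < r)%R by exact: lt_le_trans r1.
pose A := box (fun=> - r ^+ 2)%R (fun=> r ^+ 2)%R.
have mA : measurable A by exact: measurable_box.
apply: (@le_lt_trans _ _ (\int[mu]_x (\1_A x)%:E)); last first.
  rewrite integral_indic// setIT [X in X < _]heis_measure_box ?ltry// => i.
  by rewrite (@le_trans _ _ 0%R) ?oppr_le0 ?sqr_ge0.
apply: ge0_le_integral => //.
- by move=> x _; rewrite lee_fin shell_ge0.
- by apply/measurable_EFinP; exact: measurable_shell.
- by apply/measurable_EFinP; exact: measurable_indic.
move=> x _; rewrite lee_fin /shell; case: ifPn => // /andP[x1 xr].
rewrite indicE mem_set; last first.
  have h4 : (hnorm x ^+ 4 <= (r ^+ 2) ^+ 2)%R.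
    by rewrite -exprM lerXn2r ?nnegrE ?hnorm_ge0 ?(ltW r0) ?(ltW xr).
  have r12 : (1 <= r ^+ 2)%R by rewrite exprn_ege1.
  have S0 : (0 <= \sum_(i < 2 * n) tnth x (widen_ord (leqnSn (2 * n)) i) ^+ 2)%R.
    by apply: sumr_ge0 => i _; exact: sqr_ge0.
  move=> i /=; rewrite -ler_norml.
  rewrite -(@ler_pXn2r _ 2) ?nnegrE ?sqr_ge0// real_normK ?num_real//.
  rewrite hnorm_exp4 in h4.
  case: (unliftP ord_max i) => [j|] ->; last first.
    by apply: le_trans h4; rewrite lerDr sqr_ge0.
  have Sr : (\sum_(i < 2 * n) tnth x (widen_ord (leqnSn (2 * n)) i) ^+ 2 <= r ^+ 2)%R.
    rewrite -(@ler_pXn2r _ 2) ?nnegrE ?sqr_ge0//.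
    by apply: le_trans h4; rewrite lerDl sqr_ge0.
  apply: (@le_trans _ _ (r ^+ 2)%R); last by rewrite expr2 ler_peMl// sqr_ge0.
  apply: le_trans Sr; rewrite (bigD1 j)//=.
  rewrite (_ : widen_ord _ j = lift ord_max j); last first.
    by apply: val_inj; rewrite /= /bump leqNgt ltn_ord.
  by rewrite lerDl; apply: sumr_ge0 => k _; exact: sqr_ge0.
by rewrite invf_le1 ?exprn_gt0 ?exprn_ege1// (lt_le_trans _ x1).
Qed.

(** The shell contains a box of positive volume, and the density is at least r^(-Q) there. *)
Lemma integral_shell_gt0 r : (2 <= r)%R -> 0 < \int[mu]_x (shell 1 r x)%:E.
Proof.
move=> r2; have r0 : (0 < r)%R by exact: lt_le_trans r2.
(* Sides 1/N keep the sum of the first 2n squares at most 1. With the last coordinate in [1, 2] this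
   gives 1 <= |x|_h^4 <= 5 < 2^4. *)
pose N : R := (2 * n).+1%:R.
have N1 : (1 <= N)%R by rewrite ler1n.
have N0 : (0 < N)%R by exact: lt_le_trans N1.
pose s (i : 'I_(2 * n).+1) : R := if i == ord_max then 1%R else 0%R.
pose A := box s (fun i => s i + N^-1)%R.
have mA : measurable A by exact: measurable_box.
apply: (@lt_le_trans _ _ (\int[mu]_x ((r ^- dim)%:E * (\1_A x)%:E))).
  rewrite ge0_integralZl_EFin//; last 2 first.
  - by apply/measurable_EFinP; exact: measurable_indic.
  - by rewrite invr_ge0 exprn_ge0 // ltW.
  rewrite integral_indic// setIT [X in _ * X]heis_measure_box; last first.
    by move=> i; rewrite lerDl invr_ge0 ltW.
  rewrite -EFinM lte_fin mulr_gt0 ?invr_gt0 ?exprn_gt0//.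
  by apply: prodr_gt0 => i _; rewrite addrAC subrr add0r invr_gt0.
apply: ge0_le_integral => //.
- by move=> x _; rewrite -EFinM lee_fin mulr_ge0 ?invr_ge0 ?exprn_ge0 ?(ltW r0).
- by apply/measurable_EFinP; apply: measurable_funM => //; exact: measurable_indic.
- by apply/measurable_EFinP; exact: measurable_shell.
move=> x _; rewrite -EFinM lee_fin indicE.
case: (boolP (x \in A)) => [|_]; last by rewrite mulr0 shell_ge0.
rewrite inE => Ax; rewrite mulr1.
have Ni1 : (N^-1 <= 1)%R by rewrite invf_le1.
have /andP[z1 z2] : (1 <= tnth x ord_max <= 1 + N^-1)%R.
  by have := Ax ord_max; rewrite /s eqxx.
have S1 : (\sum_(i < 2 * n) tnth x (widen_ord (leqnSn (2 * n)) i) ^+ 2 <= 1)%R.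
  apply: (@le_trans _ _ (\sum_(i < 2 * n) N^-1)%R).
    apply: ler_sum => i _; have := Ax (widen_ord (leqnSn (2 * n)) i).
    rewrite /s (_ : _ == ord_max = false); last first.
      by apply/negbTE; rewrite -val_eqE/= ltn_eqF.
    rewrite add0r => /andP[x0 xN]; rewrite expr2.
    by apply: le_trans (xN); rewrite ler_piMl// (le_trans xN).
  rewrite sumr_const card_ord -mulr_natl ler_pdivrMr// mul1r.
  by rewrite ler_nat leqnSn.
have S0 : (0 <= \sum_(i < 2 * n) tnth x (widen_ord (leqnSn (2 * n)) i) ^+ 2)%R.
  by apply: sumr_ge0 => i _; exact: sqr_ge0.
have h1 : (1 <= hnorm x)%R.
  rewrite -(@ler_pXn2r _ 4) ?nnegrE ?hnorm_ge0// expr1n hnorm_exp4.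
  by rewrite ler_wpDl ?sqr_ge0// exprn_ege1.
have hr : (hnorm x < r)%R.
  rewrite -(@ltr_pXn2r _ 4) ?nnegrE ?hnorm_ge0 ?(ltW r0)// hnorm_exp4.
  apply: (@lt_le_trans _ _ (2 ^+ 4)%R); last by rewrite lerXn2r ?nnegrE ?(ltW r0).
  apply: (@le_lt_trans _ _ (1 ^+ 2 + 2 ^+ 2)%R).
    have z0 : (0 <= tnth x ord_max)%R by exact: le_trans z1.
    have z3 : (tnth x ord_max <= 2)%R.
      by rewrite (le_trans z2)// -[2%R]/(1 + 1)%R lerD2l.
    by apply: lerD; rewrite lerXn2r ?nnegrE.
  by lra.
rewrite /shell h1 hr/= lef_pV2 ?posrE ?exprn_gt0 ?(lt_le_trans _ h1)//.
by rewrite lerXn2r ?nnegrE ?hnorm_ge0 ?(ltW r0) ?(ltW hr).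
Qed.

End shells.

(** * Lower bound by truncated critical powers *)

Section hausdorff_lower_bound.
Local Open Scope classical_set_scope.
Context (R : realType) (n m : nat).
Local Notation heis := (heis R n).
Local Notation mu := (heis_measure R n).
Local Notation mum := (tuple_measure mu m).
Context (q alpha : R) (qs alphas : 'I_m -> R) (K : m.-tuple heis -> R).
Hypotheses (q_gt1 : 1 < q) (qs_gt1 : forall j, 1 < qs j)
  (qE : q^-1 = \sum_(j < m) (qs j)^-1) (alphaE : alpha = \sum_(j < m) alphas j)
  (K_ge0 : forall y, 0 <= K y) (mK : measurable_fun setT K).

Local Notation dim := (heis_dim n).
Local Notation a j := (- (alphas j / q) - dim%:R / qs j).

Let q_gt0 : 0 < q. Proof. exact: lt_trans q_gt1. Qed.
Let qs_gt0 j : 0 < qs j. Proof. exact: lt_trans (qs_gt1 j). Qed.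
Let qN0 : q != 0. Proof. by rewrite gt_eqF. Qed.
Let qsN0 j : qs j != 0. Proof. by rewrite gt_eqF. Qed.

Let wt (y : m.-tuple heis) := K y * \prod_(j < m) hnorm (tnth y j) `^ a j.

Let wt_ge0 y : 0 <= wt y.
Proof. by rewrite mulr_ge0// prodr_ge0// => j _; rewrite powR_ge0. Qed.

Let mhnorm j : measurable_fun setT (fun y : m.-tuple heis => hnorm (tnth y j)).
Proof. by apply: (measurableT_comp (@measurable_hnorm R n)); exact: measurable_tnth. Qed.

Let mwt : measurable_fun setT wt.
Proof.
apply: measurable_funM => //; apply: measurable_prod => j _.
exact: (measurableT_comp (measurable_powR _)).
Qed.

Definition in_shells r (y : m.-tuple heis) :=
  [forall j, r^-1 <= hnorm (tnth y j) < r].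

(** The exponent is critical: the untruncated power has a weighted norm that diverges
    logarithmically at 0 and at infinity. *)
Definition test_fun r N j (x : heis) : R :=
  if 1 <= hnorm x < r ^+ N then hnorm x `^ a j else 0.

Let wt_on r y := if in_shells r y then wt y else 0.

Let wt_on_ge0 r y : 0 <= wt_on r y.
Proof. by rewrite /wt_on; case: ifP. Qed.

Let mwt_on r : measurable_fun setT (wt_on r).
Proof.
apply: measurable_if_set => //.
rewrite (_ : [set y | _] = \bigcap_(j : 'I_m)
    [set y : m.-tuple heis | r^-1 <= hnorm (tnth y j) < r]).
  apply: fin_bigcap_measurable => // j _; exact: measurable_shell_cond.
apply/seteqP; split => y /=; first by move=> /forallP H j _; exact: H.
by move=> H; apply/forallP => j; exact: H.
Qed.

Lemma measurable_test_fun r N j : measurable_fun setT (test_fun r N j).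
Proof.
apply: measurable_if_set.
  by apply: measurable_shell_cond; exact: measurable_hnorm.
by apply: (measurableT_comp (measurable_powR _)); exact: measurable_hnorm.
Qed.

Lemma radial_test_fun r N j : radial (test_fun r N j).
Proof. by move=> x y xy; rewrite /test_fun xy. Qed.

Lemma test_fun_ge0 r N j x : 0 <= test_fun r N j x.
Proof. by rewrite /test_fun; case: ifP => // _; exact: powR_ge0. Qed.

Local Open Scope ereal_scope.

Lemma hLnorm_test_fun r N j : (1 <= r)%R ->
  hLnorm (qs j) (qs j * alphas j / q) (EFin \o test_fun r N j) =
  (N%:R%:E * \int[mu]_x (shell 1 r x)%:E) `^ (qs j)^-1.
Proof.
move=> r1; rewrite /hLnorm -(integral_shell_exp n 0 N r1) expr0 add0n.
congr (_ `^ _); apply: eq_integral => x _.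
rewrite /= ger0_norm ?test_fun_ge0// /test_fun /shell.
case: ifPn => [/andP[x1 _]|_]; last by rewrite powR0// mul0e.
have x0 : (0 < hnorm x)%R by exact: lt_le_trans x1.
rewrite -EFinM -powRrM -powRD; last by rewrite (lt0r_neq0 x0) implybT.
rewrite -powR_invn ?(ltW x0)//; congr (_ `^ _)%:E.
(* The exponents of |x|_h add up to -Q. *)
by field; rewrite qN0 qsN0.
Qed.

(** The degree of homogeneity of H^h on critical powers, equal to -(alpha + Q)/q. Its q-th power
    times the weight is again |x|_h^(-Q). *)
Let e := (\sum_(j < m) a j)%R.

Let eq_e : (e * q + alpha = - dim%:R)%R.
Proof.
rewrite /e alphaE sumrB -[X in (_ - X)%R]mulr_sumr -qE sumrN -mulr_suml.
by field.
Qed.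

(** For 1/r <= |y_j|_h < r the dilated point has norm in [1, r^(k+2)[, inside the support of the
    test function. One shell is given up at each end, whence k + 2 shells against k. *)
Lemma hausdorff_test_fun_ge r k x : (1 <= r)%R -> (r <= hnorm x < r ^+ k.+1)%R ->
  (hnorm x `^ e)%:E * \int[mum]_y (wt_on r y)%:E <=
  hausdorff K (test_fun r k.+2) x.
Proof.
move=> r1 /andP[xr xk]; have r0 : (0 < r)%R by exact: lt_le_trans r1.
have x0 : (0 < hnorm x)%R by exact: lt_le_trans xr.
rewrite -ge0_integralZl_EFin//; last 3 first.
- by move=> y _; rewrite lee_fin.
- exact/measurable_EFinP.
- exact: powR_ge0.
apply: (le_integral_off_null measurable0 (measure0 mum)) => [y|y|y _].
- by rewrite -EFinM lee_fin mulr_ge0 ?powR_ge0.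
- by rewrite lee_fin mulr_ge0// prodr_ge0// => j _; exact: test_fun_ge0.
rewrite -EFinM lee_fin /wt_on; case: ifPn => [/forallP yr|_]; last first.
  by rewrite mulr0 mulr_ge0// prodr_ge0// => j _; exact: test_fun_ge0.
rewrite /wt mulrCA ler_wpM2l// /e powR_sum// -big_split/=.
rewrite le_eqVlt; apply/orP; left; apply/eqP; apply: eq_bigr => j _.
have /andP[y1 yr1] := yr j.
rewrite /test_fun hnorm_dilation ?hnorm_ge0// ifT ?powRM ?hnorm_ge0//.
apply/andP; split.
  by rewrite -(mulfV (lt0r_neq0 r0)) ler_pM// ?invr_ge0 ltW.
by rewrite exprSr ltr_pM ?hnorm_ge0.
Qed.

Lemma hLnorm_hausdorff_test_fun_ge r k : (1 <= r)%R ->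
  \int[mum]_y (wt_on r y)%:E *
    (k%:R%:E * \int[mu]_x (shell 1 r x)%:E) `^ q^-1 <=
  hLnorm q alpha (hausdorff K (test_fun r k.+2)).
Proof.
move=> r1; have r0 : (0 < r)%R by exact: lt_le_trans r1.
set c := \int[mum]_y _; have c0 : 0 <= c.
  by apply: integral_ge0 => y _; rewrite lee_fin.
set L := \int[mu]_x _; have L0 : 0 <= L.
  by apply: integral_ge0 => x _; rewrite lee_fin shell_ge0.
have kL0 : 0 <= k%:R%:E * L by rewrite mule_ge0// lee_fin.
have -> : c * (k%:R%:E * L) `^ q^-1 = (c `^ q * (k%:R%:E * L)) `^ q^-1.
  by rewrite poweRM ?poweR_ge0// -poweRrM mulfV// poweRe1.
apply: gt0_ler_poweR.
- by rewrite invr_ge0 ltW.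
- by rewrite in_itv/= leey mule_ge0 ?poweR_ge0.
- rewrite in_itv/= leey andbT; apply: integral_ge0 => x _.
  by rewrite mule_ge0 ?poweR_ge0// lee_fin powR_ge0.
(* The k middle shells run from r to r^(k+1), hence the starting exponent 1. *)
rewrite -(integral_shell_exp n 1 k r1) -ge0_integralZl; last 4 first.
- exact: measurableT.
- by apply/measurable_EFinP; exact: measurable_shell.
- by move=> x _; rewrite lee_fin shell_ge0.
- exact: poweR_ge0.
apply: (le_integral_off_null measurable0 (measure0 mu)) => [x|x|x _].
- by rewrite mule_ge0 ?poweR_ge0// lee_fin shell_ge0.
- by rewrite mule_ge0 ?poweR_ge0// lee_fin powR_ge0.
rewrite /shell expr1 add1n; case: ifPn => [xr|_]; last first.
  by rewrite mule0 mule_ge0 ?poweR_ge0// lee_fin powR_ge0.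
have x0 : (0 < hnorm x)%R by case/andP: xr => xr _; exact: lt_le_trans xr.
have Hx := hausdorff_test_fun_ge r1 xr.
have Hx0 : 0 <= (hnorm x `^ e)%:E * c by rewrite mule_ge0// lee_fin powR_ge0.
apply: (@le_trans _ _ (((hnorm x `^ e)%:E * c) `^ q * (hnorm x `^ alpha)%:E)).
  rewrite poweRM ?lee_fin ?powR_ge0// poweR_EFin -powRrM muleAC -EFinM.
  rewrite -powRD; last by rewrite (lt0r_neq0 x0) implybT.
  by rewrite eq_e powR_invn ?(ltW x0)// muleC.
apply: lee_wpmul2r; first by rewrite lee_fin powR_ge0.
apply: gt0_ler_poweR; rewrite ?in_itv/= ?leey ?andbT ?abse_ge0 ?(ltW q_gt0)//.
by rewrite (le_trans Hx)// lee_abs.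
Qed.

Let opnorm_ratio_ge r k : (2 <= r)%R ->
  \int[mum]_y (wt_on r y)%:E * (k%:R / k.+2%:R)%:E <=
  hausdorff_opnorm K q qs alphas alpha.
Proof.
move=> r2; have r1 : (1 <= r)%R by apply: le_trans r2; rewrite ler1n.
have L0 := integral_shell_gt0 n r2; have Loo := integral_shell_lty n r1.
have := hLnorm_hausdorff_test_fun_ge k r1.
have hL j := hLnorm_test_fun k.+2 j r1.
move: L0 Loo hL; case: (\int[mu]_x _) => [l| |]//.
rewrite lte_fin => l0 _ hL Hge.
have kl0 : (0 < k.+2%:R * l)%R by rewrite mulr_gt0// ltr0n.
set H := hLnorm _ _ _ in Hge.
have opH : H / ((k.+2%:R * l) `^ q^-1)%:E <= hausdorff_opnorm K q qs alphas alpha.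
  apply: ereal_sup_ubound; exists (test_fun r k.+2); split; last first.
    under eq_bigr => j _ do rewrite hL -EFinM poweR_EFin.
    (* The norms of the test functions are powers 1/q_j of the same mass, and these exponents sum to
       1/q. *)
    by rewrite prodEFin -powR_sum// -qE.
  move=> j; split.
  - by apply: completed_measurable_funW; exact: measurable_test_fun.
  - exact: radial_test_fun.
  - by rewrite hL poweR_gt0// -EFinM lte_fin.
  - by rewrite hL -EFinM ltry.
apply: le_trans opH.
have D0 : (0 < (k.+2%:R * l) `^ q^-1)%R by exact: powR_gt0.
rewrite inver gt_eqF//.
apply: (@le_trans _ _ (\int[mum]_y (wt_on r y)%:E *
  (k%:R%:E * l%:E) `^ q^-1 * ((k.+2%:R * l) `^ q^-1)^-1%:E)); last first.
  by apply: lee_wpmul2r => //; rewrite lee_fin invr_ge0 ltW.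
rewrite -muleA; apply: lee_wpmul2l.
  by apply: integral_ge0 => y _; rewrite lee_fin.
rewrite -(EFinM k%:R l) poweR_EFin -EFinM lee_fin.
have -> : ((k%:R * l) `^ q^-1 = (k%:R / k.+2%:R) `^ q^-1 * (k.+2%:R * l) `^ q^-1)%R.
  rewrite -powRM ?divr_ge0 ?ler0n ?(ltW kl0)//; congr (_ `^ _)%R.
  by rewrite mulrA divfK// pnatr_eq0.
rewrite mulfK ?gt_eqF//.
have [->|k0] := eqVneq k 0%N; first by rewrite mul0r powR_ge0.
(* A base in ]0, 1] does not decrease under the exponent 1/q <= 1, so the simpler ratio k/(k+2) is a
   lower bound. *)
apply: ger1_powR; last by rewrite invf_le1// ltW.
by rewrite divr_gt0 ?ltr0n ?lt0n//= ler_pdivrMr ?ltr0n// mul1r ler_nat -addn2 leq_addr.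
Qed.

Lemma hausdorff_opnorm_ge r : (2 <= r)%R ->
  \int[mum]_y (wt_on r y)%:E <= hausdorff_opnorm K q qs alphas alpha.
Proof.
move=> r2; have := fun k => opnorm_ratio_ge k r2.
have : 0 <= \int[mum]_y (wt_on r y)%:E.
  by apply: integral_ge0 => y _; rewrite lee_fin.
case: (integral _ _ _) => [c| |]//; last first.
  (* If the truncated integral is infinite, already k = 1 forces an infinite operator norm. *)
  by move=> _ /(_ 1%N); rewrite gt0_mulye// lte_fin divr_gt0// ltr0n.
rewrite lee_fin => c0; case: hausdorff_opnorm => [M| |] H.
- rewrite lee_fin leNgt; apply/negP => Mc.
  have M0 : (0 <= M)%R by have := H 0%N; rewrite mul0r mule0 lee_fin.
  have cM : (0 < c - M)%R by rewrite subr_gt0.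
  (* The inequality c k/(k+2) > M amounts to k > 2M/(c - M), so a large k contradicts the bound. *)
  pose x := (2 * M / (c - M))%R.
  have x0 : (0 <= x)%R by rewrite divr_ge0 ?mulr_ge0// ltW.
  have := archi_boundP x0; set k := Num.bound x.
  rewrite /x ltr_pdivrMr// => Hk.
  have := H k; rewrite -EFinM lee_fin mulrA ler_pdivrMr ?ltr0n//.
  rewrite -addn2 natrD; apply/negP; rewrite -ltNge.
  by move: Hk; rewrite mulrBr; lra.
- by rewrite leey.
- by have := H 0%N; rewrite mul0r mule0 leeNy_eq.
Qed.

Let in_shells_le r s y : (0 < r)%R -> (r <= s)%R -> in_shells r y -> in_shells s y.
Proof.
move=> r0 rs /forallP yr; apply/forallP => j; have /andP[y1 y2] := yr j.
rewrite (lt_le_trans y2 rs) andbT (le_trans _ y1)//.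
by rewrite lef_pV2 ?posrE// (lt_le_trans r0).
Qed.

Let near_in_shells y : ~ hnorm_zero y ->
  \forall k \near \oo, in_shells k.+2%:R y.
Proof.
move=> /not_hnorm_zero y0.
(* A radius above the sum of these terms exceeds every |y_j|_h and every 1/|y_j|_h. *)
pose h j := (hnorm (tnth y j) + (hnorm (tnth y j))^-1)%R.
have h0 j : (0 <= h j)%R by rewrite addr_ge0 ?invr_ge0 ?hnorm_ge0.
have b0 : (0 <= \sum_j h j)%R by apply: sumr_ge0.
exists (Num.bound (\sum_j h j)) => // k /= bk.
apply/forallP => j.
have hk : (h j < k.+2%:R)%R.
  apply: (@le_lt_trans _ _ (\sum_j h j)%R).
    by rewrite (bigD1 j)//= lerDl sumr_ge0.
  apply: (lt_le_trans (archi_boundP b0)); rewrite ler_nat.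
  by rewrite (leq_trans bk)// -addn2 leq_addr.
apply/andP; split; last first.
  by apply: le_lt_trans hk; rewrite lerDl invr_ge0 hnorm_ge0.
rewrite -[leRHS]invrK lef_pV2 ?posrE ?ltr0n ?invr_gt0//.
by apply/ltW/(le_lt_trans _ hk); rewrite lerDr hnorm_ge0.
Qed.

(** Monotone convergence along the radii k + 2, which are at least 2 as positivity of the shell mass
    requires. *)
Lemma hausdorff_const_le :
  hausdorff_const K q qs alphas <= hausdorff_opnorm K q qs alphas alpha.
Proof.
pose g k (y : m.-tuple heis) := (wt_on k.+2%:R y)%:E.
have [mZ Z0] := hnorm_zero_null R n m.
have -> : hausdorff_const K q qs alphas = \int[mum]_y limn (g ^~ y).
  apply: (eq_integral_off_null mZ Z0) => y yZ; apply/esym/cvg_lim => //.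
  apply: cvg_near_cst; near=> k; rewrite /g /wt_on ifT//.
  by near: k; exact: near_in_shells.
have H : \int[mum]_y g k y @[k --> \oo] --> \int[mum]_y limn (g ^~ y).
  apply: cvg_monotone_convergence => //.
  - by move=> k; exact/measurable_EFinP.
  - by move=> k y _; rewrite lee_fin.
  - move=> y _ k l kl; rewrite lee_fin /wt_on.
    case: ifPn => [yk|_]; last by case: ifP.
    by rewrite (in_shells_le _ _ yk) ?ltr0n ?ler_nat ?ltnS.
rewrite -(cvg_lim _ H)//; apply: lime_le; first exact: cvgP H.
by apply: nearW => k; apply: hausdorff_opnorm_ge; rewrite ler_nat.
Unshelve. all: by end_near. Qed.

End hausdorff_lower_bound.

(** * The norm identity for a Borel kernel and completed-measurable functions *)

Section hausdorff_norm.
Local Open Scope classical_set_scope.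
Local Open Scope ereal_scope.
Context (R : realType) (n m : nat).
Local Notation heis := (heis R n).
Local Notation mu := (heis_measure R n).
Local Notation mum := (tuple_measure mu m).

Lemma eq_hLnorm_off_null (p a : R) (M : set heis) (f g : heis -> \bar R) :
  measurable M -> mu M = 0 -> (forall x, ~ M x -> f x = g x) ->
  hLnorm p a f = hLnorm p a g.
Proof.
move=> mM M0 fg; congr (_ `^ _).
by apply: (eq_integral_off_null mM M0) => x Mx; rewrite fg.
Qed.

(** At a fixed x of positive norm, dilation preserves null sets, so the tuples y that meet an
    exceptional set in some coordinate form a null set. *)
Lemma eq_hausdorff_off_null (K : m.-tuple heis -> R) (f g : 'I_m -> heis -> R)
    (M : 'I_m -> set heis) x :
  (forall j, measurable (M j)) -> (forall j, mu (M j) = 0) ->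
  (forall j x, ~ M j x -> f j x = g j x) -> (0 < hnorm x)%R ->
  hausdorff K f x = hausdorff K g x.
Proof.
move=> mM M0 fg x0.
have mD j : measurable (hdilation (hnorm x) @^-1` M j).
  apply: preimage_measurable => //.
  exact: (measurable_hdilation (measurable_cst _) (@measurable_id _ _ _)).
have D0 j : mu (hdilation (hnorm x) @^-1` M j) = 0.
  exact: heis_measure_preimage_hdilation.
have [mN N0] := tuple_measure_null_coordinates mD D0.
apply: (eq_integral_off_null mN N0) => y yN; congr (_ * _)%:E.
by apply: eq_bigr => j _; apply: fg => Mj; apply: yN; exists j.
Qed.

Context (q alpha : R) (qs alphas : 'I_m -> R) (K : m.-tuple heis -> R).
Hypotheses (q_gt1 : (1 < q)%R) (qs_gt1 : (forall j, 1 < qs j)%R)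
  (qE : q^-1%R = (\sum_(j < m) (qs j)^-1)%R)
  (alphaE : alpha = (\sum_(j < m) alphas j)%R)
  (K_ge0 : forall y, (0 <= K y)%R) (mK : measurable_fun setT K).

Local Notation C := (hausdorff_const K q qs alphas).
Local Notation norm j := (hLnorm (qs j) (qs j * alphas j / q)).

Let q_gt0 : (0 < q)%R. Proof. exact: lt_trans q_gt1. Qed.
Let qN0 : q != 0%R. Proof. by rewrite gt_eqF. Qed.
Let qsN0 j : qs j != 0%R. Proof. by rewrite gt_eqF// (lt_trans _ (qs_gt1 j)). Qed.

Let C_ge0 : 0 <= C.
Proof.
apply: integral_ge0 => y _; rewrite lee_fin mulr_ge0// prodr_ge0// => j _.
exact: powR_ge0.
Qed.

Lemma hLnorm_hausdorff_le (g : 'I_m -> heis -> R) :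
  (forall j, measurable_fun setT (g j)) -> (forall j, radial (g j)) ->
  (forall j, 0 < norm j (EFin \o g j) < +oo) ->
  hLnorm q alpha (hausdorff K g) / \prod_(j < m) norm j (EFin \o g j) <= C.
Proof.
move=> mg rg gfin.
(* Powers with exponent 1/q_j fix 0 and +oo, so a norm strictly between them comes from a positive
   finite integral. *)
have HB j : exists b : R, (0 < b)%R /\
    \int[mu]_x (`|g j x| `^ qs j * hnorm x `^ (qs j * alphas j / q))%:E = b%:E.
  have /andP[] := gfin j; rewrite /hLnorm.
  have -> : \int[mu]_x (`|(EFin \o g j) x| `^ qs j *
      (hnorm x `^ (qs j * alphas j / q))%:E) =
    \int[mu]_x (`|g j x| `^ qs j * hnorm x `^ (qs j * alphas j / q))%:E by [].
  have : 0 <= \int[mu]_x (`|g j x| `^ qs j * hnorm x `^ (qs j * alphas j / q))%:E.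
    by apply: integral_ge0 => x _; rewrite lee_fin mulr_ge0// powR_ge0.
  have pN0 : ((qs j)^-1 != 0)%R by rewrite invr_eq0.
  case: (integral _ _ _) => [b| |] //.
    rewrite lee_fin => b0 H _; exists b; split => //.
    rewrite lt0r b0 andbT; apply/eqP => bE; move: H.
    by rewrite bE poweR0r// ltxx.
  by rewrite poweRyr// ltxx.
have [B HB'] := choice HB.
have B0 j : (0 < B j)%R by have [] := HB' j.
have FE j : \int[mu]_x (`|g j x| `^ qs j * hnorm x `^ (qs j * alphas j / q))%:E =
  (B j)%:E by have [] := HB' j.
have normE j : norm j (EFin \o g j) = (B j `^ (qs j)^-1)%:E.
  by rewrite -poweR_EFin -FE.
under eq_bigr => j _ do rewrite normE.
rewrite prodEFin.
have D0 : (0 < \prod_(j < m) B j `^ (qs j)^-1)%R.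
  by apply: prodr_gt0 => j _; exact: powR_gt0.
rewrite inver gt_eqF// lee_pdivrMr//.
have H := integral_hausdorff_le q_gt1 qs_gt1 qE alphaE K_ge0 mK mg rg B0 FE.
(* Written as a q-th root, the claim follows from the integrated bound by monotonicity. *)
have -> : C * (\prod_(j < m) B j `^ (qs j)^-1)%:E =
    (C `^ q * (\prod_(j < m) B j `^ (q / qs j))%:E) `^ q^-1.
  rewrite poweRM ?poweR_ge0 ?lee_fin//; last first.
    by apply: prodr_ge0 => j _; exact: powR_ge0.
  rewrite -poweRrM mulfV// poweRe1// poweR_EFin powR_prod; last first.
    by move=> j; exact: powR_ge0.
  congr (_ * _%:E); apply: eq_bigr => j _.
  by rewrite -powRrM mulrAC divff// mul1r.
apply: gt0_ler_poweR H.
- by rewrite invr_ge0 ltW.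
- rewrite in_itv/= leey andbT; apply: integral_ge0 => x _.
  by rewrite mule_ge0 ?poweR_ge0// lee_fin powR_ge0.
- rewrite in_itv/= leey andbT mule_ge0 ?poweR_ge0// lee_fin.
  by apply: prodr_ge0 => j _; exact: powR_ge0.
Qed.

(** For the upper bound each f_j is replaced by a radial Borel version, which changes neither its
    norm nor H^h(f) at points of positive norm. *)
Lemma hausdorff_opnormE : hausdorff_opnorm K q qs alphas alpha = C.
Proof.
apply/eqP; rewrite eq_le; apply/andP; split; last exact: hausdorff_const_le.
apply: ge_ereal_sup => _ [f [Hf ->]].
have Hg j : exists gM : (heis -> R) * set heis, [/\ measurable gM.2, mu gM.2 = 0,
    measurable_fun setT gM.1, radial gM.1 & forall x, ~ gM.2 x -> f j x = gM.1 x].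
  have [mf rf _ _] := Hf j.
  by have [g [M H]] := radial_version mf rf; exists (g, M).
have [gM HgM] := choice Hg.
pose g j := (gM j).1; pose M j := (gM j).2.
have mM j : measurable (M j) by have [] := HgM j.
have M0 j : mu (M j) = 0 by have [] := HgM j.
have fg j x : ~ M j x -> f j x = g j x.
  by have [_ _ _ _ H] := HgM j; exact: H.
have normE j : norm j (EFin \o f j) = norm j (EFin \o g j).
  by apply: (eq_hLnorm_off_null _ _ (mM j) (M0 j)) => x /fg /= ->.
rewrite (eq_bigr _ (fun j _ => normE j)).
have -> : hLnorm q alpha (hausdorff K f) = hLnorm q alpha (hausdorff K g).
  apply: (eq_hLnorm_off_null _ _ (@hnorm_eq0_measurable R n) (@hnorm_eq0_null R n)).
  by move=> x /= /hnorm_gt0; exact: (eq_hausdorff_off_null K mM M0 fg).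
apply: hLnorm_hausdorff_le => j; try by have [] := HgM j.
by have [_ _ f0 foo] := Hf j; rewrite -normE f0.
Qed.

End hausdorff_norm.

(** * Passage to a kernel measurable for the completed measure *)

Theorem theorem3p1 (R : realType) (n m : nat) (q alpha : R)
    (qs alphas : 'I_m -> R) (K : m.-tuple (heis R n) -> R)
    (n_ge1 : (1 <= n)%N) (m_ge1 : (1 <= m)%N)
    (q_gt1 : 1 < q) (qs_gt1 : forall j, 1 < qs j)
    (qE : q^-1 = \sum_(j < m) (qs j)^-1)
    (alphaE : alpha = \sum_(j < m) alphas j)
    (K_gt0 : forall y, 0 < K y)
    (K_meas : completed_measurable_fun (tuple_measure (heis_measure R n) m) K)
    (K_radial : radial_kernel K)
    (C_fin : (hausdorff_const K q qs alphas < +oo)%E) :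
  hausdorff_opnorm K q qs alphas alpha = hausdorff_const K q qs alphas.
Proof.
(* The Borel version of K vanishes on M, so it is only nonnegative, as the preceding bounds assume.
   It yields the same operator at every x and the same C^h. *)
have [M [mM M0 mK']] := completed_version K_meas.
set K' := (fun y => _) in mK'.
have K'_ge0 y : 0 <= K' y by rewrite /K'; case: ifP => // _; exact: ltW.
have KK' y : ~ M y -> K y = K' y by move=> yM; rewrite /K' memNset.
have hE (f : 'I_m -> heis R n -> R) x : hausdorff K f x = hausdorff K' f x.
  by apply: (eq_integral_off_null mM M0) => y /KK' ->.
have -> : hausdorff_const K q qs alphas = hausdorff_const K' q qs alphas.
  by apply: (eq_integral_off_null mM M0) => y /KK' ->.
rewrite -(hausdorff_opnormE q_gt1 qs_gt1 qE alphaE K'_ge0 mK').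
rewrite /hausdorff_opnorm (_ : hausdorff K = hausdorff K')//.
by apply/funext => f; apply/funext => x.
Qed.
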